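(* Let $n\ge2$, let $X_1,\dots,X_n$ be Banach spaces and $D_k\in\mathcal{B}(X_k)$, and assume that $D_s-\lambda$ satisfies the complements condition for all $2\le s\le n-1$ and all $\lambda\in\mathbb{C}$. Then for every $A\in\mathcal{B}_n$, $$\bigcup_{k=1}^n\sigma_{e}(D_k)=\sigma_{e}(T_n^d(A))\cup\Delta,\qquad \Delta=(\Delta_1\cup\Delta_2)\cap\rho_{le}(D_1)\cap\rho_{re}(D_n),$$ where $\Delta_1$ is the set of $\lambda\in\mathbb{C}$ for which there is $k\in\{2,\dots,n-1\}$ such that either (a) $\alpha(D_k-\lambda)=\sum_{s=1}^{k-1}\beta(D_s-\lambda)=\infty$ and $\alpha(D_s-\lambda)<\infty$ for $2\le s\le k-1$, or (b) $\beta(D_k-\lambda)=\sum_{s=k+1}^{n}\alpha(D_s-\lambda)=\infty$ and $\beta(D_s-\lambda)<\infty$ for $k+1\le s\le n-1$; and $\Delta_2$ is the set of $\lambda\in\mathbb{C}$ such that either (c) $\alpha(D_n-\lambda)=\sum_{s=1}^{n-1}\beta(D_s-\lambda)=\infty$ and $\alpha(D_s-\lambda)<\infty$ for $2\le s\le n-1$, or (d) $\beta(D_1-\lambda)=\sum_{s=2}^{n}\alpha(D_s-\lambda)=\infty$ and $\beta(D_s-\lambda)<\infty$ for $2\le s\le n-1$.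
   Context: For a bounded operator $T$ between Banach spaces, $\alpha(T)=\dim\mathcal{N}(T)$, $\beta(T)=\operatorname{codim}\mathcal{R}(T)$, values in $\{0,1,\dots\}\cup\{\infty\}$, sums taken in this extended set. $T\in\mathcal{B}(X,Y)$ satisfies the complements condition if $\mathcal{N}(T)$ is topologically complemented in $X$ and $\overline{\mathcal{R}(T)}$ is topologically complemented in $Y$. $T$ is left Fredholm if $\alpha(T)<\infty$ and $\mathcal{R}(T)$ is closed and complemented; right Fredholm if $\beta(T)<\infty$ and $\mathcal{N}(T)$ is complemented; Fredholm if $\alpha(T)<\infty$ and $\beta(T)<\infty$. $\sigma_{le},\sigma_{re},\sigma_e$ denote the sets of $\lambda\in\mathbb{C}$ with $\lambda-T$ not left Fredholm, not right Fredholm, not Fredholm respectively; $\rho_{le},\rho_{re}$ their complements. $\mathcal{B}_n$ is the set of tuples $A=(A_{ij})_{1\le i<j\le n}$, $A_{ij}\in\mathcal{B}(X_j,X_i)$; $T_n^d(A)$ is the upper triangular operator matrix on $X_1\oplus\cdots\oplus X_n$ with diagonal $D_1,\dots,D_n$, entries $A_{ij}$ above the diagonal and zeros below. *)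

(* Defs.v *)
From HB Require Import structures.
From mathcomp Require Import all_boot all_order all_algebra.
From mathcomp Require Import all_classical all_reals all_analysis.
From mathcomp Require Export complex.
Import numFieldNormedType.Exports.
Set Implicit Arguments.
Unset Strict Implicit.
Unset Printing Implicit Defensive.
Import Order.TTheory GRing.Theory Num.Theory.
Local Open Scope classical_set_scope.
Local Open Scope ring_scope.

(* Extended naturals {0,1,...} ∪ {∞}: None stands for ∞.               *)
Definition enat := option nat.
Definition eaddn (a b : enat) : enat :=
  match a, b with Some x, Some y => Some (x + y)%N | _, _ => None end.

Section Dim.
Variables (K : pzRingType) (V : lmodType K).

Definition spanned_by (S : set V) (k : nat) : Prop :=
  exists s : 'I_k -> V, (forall i, S (s i)) /\
    forall v, S v -> exists c : 'I_k -> K, v = \sum_(i < k) c i *: s i.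

Definition cospanned_by (S : set V) (k : nat) : Prop :=
  exists s : 'I_k -> V, forall v, exists u (c : 'I_k -> K),
    S u /\ v = u + \sum_(i < k) c i *: s i.

Definition edim (S : set V) : enat :=
  match pselect (exists k, `[< spanned_by S k >]) with
  | left h => Some (ex_minn h)
  | right _ => None
  end.

Definition ecodim (S : set V) : enat :=
  match pselect (exists k, `[< cospanned_by S k >]) with
  | left h => Some (ex_minn h)
  | right _ => None
  end.

Definition subspace (N : set V) : Prop :=
  N 0 /\ forall (a : K) x y, N x -> N y -> N (a *: x + y).
End Dim.

Section Ops.
Variables (K : pzRingType) (V W : lmodType K).
Definition kernel (T : V -> W) : set V := [set x | T x = 0].
Definition alpha (T : V -> W) : enat := edim (kernel T).
Definition beta (T : V -> W) : enat := ecodim (range T).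
Definition subl (T : V -> V) (l : K) : V -> V := fun x => T x - l *: x.
Definition is_linear (T : V -> W) : Prop :=
  forall (a : K) x y, T (a *: x + y) = a *: T x + T y.
Definition fredholm (T : V -> W) : Prop := alpha T <> None /\ beta T <> None.
End Ops.

Section Compl.
Variables (K : numFieldType) (V : normedModType K).
Definition complemented (M : set V) : Prop :=
  closed M /\ exists N : set V, subspace N /\ closed N /\
    M `&` N = [set 0] /\
    forall v, exists x y, M x /\ N y /\ v = x + y.
End Compl.

Section Top.
Variables (K : numFieldType) (V W : normedModType K).

Definition bounded_op (T : V -> W) : Prop := is_linear T /\ continuous T.

Definition complements_condition (T : V -> W) : Prop :=
  complemented (kernel T) /\ complemented (closure (range T)).

Definition left_fredholm (T : V -> W) : Prop :=
  alpha T <> None /\ closed (range T) /\ complemented (range T).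

Definition right_fredholm (T : V -> W) : Prop :=
  beta T <> None /\ complemented (kernel T).
End Top.

Section DProd.
Variables (K : pzRingType) (n : nat) (Y : 'I_n -> lmodType K).

Definition dprod := forall i : 'I_n, Y i.

HB.instance Definition _ := gen_eqMixin dprod.
HB.instance Definition _ := gen_choiceMixin dprod.

Definition dp_zero : dprod := fun i => 0.
Definition dp_add (x y : dprod) : dprod := fun i => x i + y i.
Definition dp_opp (x : dprod) : dprod := fun i => - x i.
Definition dp_scale (a : K) (x : dprod) : dprod := fun i => a *: x i.

Lemma dp_addA : associative dp_add.
Proof. by move=> x y z; apply: functional_extensionality_dep => i; rewrite /dp_add addrA. Qed.
Lemma dp_addC : commutative dp_add.
Proof. by move=> x y; apply: functional_extensionality_dep => i; rewrite /dp_add addrC. Qed.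
Lemma dp_add0 : left_id dp_zero dp_add.
Proof. by move=> x; apply: functional_extensionality_dep => i; rewrite /dp_add /dp_zero add0r. Qed.
Lemma dp_addN : left_inverse dp_zero dp_opp dp_add.
Proof. by move=> x; apply: functional_extensionality_dep => i; rewrite /dp_add /dp_opp /dp_zero addNr. Qed.

HB.instance Definition _ :=
  GRing.isZmodule.Build dprod dp_addA dp_addC dp_add0 dp_addN.

Lemma dp_scaleA a b (x : dprod) : dp_scale a (dp_scale b x) = dp_scale (a * b) x.
Proof. by apply: functional_extensionality_dep => i; rewrite /dp_scale scalerA. Qed.
Lemma dp_scale1 : left_id 1 dp_scale.
Proof. by move=> x; apply: functional_extensionality_dep => i; rewrite /dp_scale scale1r. Qed.
Lemma dp_scaleDr : right_distributive dp_scale (@GRing.add dprod).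
Proof. by move=> a x y; apply: functional_extensionality_dep => i; rewrite /dp_scale scalerDr. Qed.
Lemma dp_scaleDl (x : dprod) : {morph dp_scale^~ x : a b / a + b}.
Proof. by move=> a b; apply: functional_extensionality_dep => i; rewrite /dp_scale scalerDl. Qed.

HB.instance Definition _ :=
  GRing.Zmodule_isLmodule.Build K dprod dp_scaleA dp_scale1 dp_scaleDr dp_scaleDl.

(* Upper triangular operator matrix T_n^d(A): diagonal D_k, entries A_ij (i<j)
   above the diagonal, zeros below. Entries A i j with i >= j are ignored. *)
Definition Tmat (D : forall k, Y k -> Y k) (A : forall i j : 'I_n, Y j -> Y i)
  : dprod -> dprod :=
  fun x i => D i (x i) + \sum_(j < n | (i < j)%N) A i j (x j).
End DProd.

(* Main.v *)
Require Import Defs.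
From HB Require Import structures.
From mathcomp Require Import all_boot all_order all_algebra.
From mathcomp Require Import all_classical all_reals all_analysis.
From mathcomp Require Import complex.
Import numFieldNormedType.Exports.
Import Order.TTheory GRing.Theory Num.Theory.
Local Open Scope classical_set_scope.
Local Open Scope ring_scope.
From mathcomp Require Import ring lra.

(* Write T for the triangular operator and shift everything by lambda.

   Algebra.  If ker T is finite dimensional and the ranges of all D_s with s < k
   have finite codimension, then T maps X_1 + ... + X_(k-1) onto a subspace of
   finite codimension, so every z in ker D_k is, up to finitely many dimensions,
   the k-th component of a vector of ker T; hence alpha(D_k) is finite.  Dually,
   beta(D_k) is finite when T has a range of finite codimension and alpha(D_s) is
   finite for all s > k.  So if T is Fredholm but some D_k is not, some
   alpha(D_k) is infinite, and the least such k satisfies (a) or (c).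

   Analysis.  A Fredholm T has a bounded inverse S modulo operators of finite
   rank.  Its corner entries are a left inverse of D_1 and a right inverse of
   D_n modulo finite rank; the error is corrected with functionals provided by
   the Hahn-Banach theorem, which yields bounded projections onto R(D_1) and
   N(D_n).

   The direct sum carries no topology in the statement, so the analysis is
   carried out with explicit real-valued norms. *)

(** * Finite dimension and finite codimension *)

(* These two names are otherwise shadowed by those of MathComp-Analysis. *)
Notation subspace := Defs.subspace.
Notation kernel := Defs.kernel.

Section LinearMaps.
Set Implicit Arguments.
Unset Strict Implicit.
Context {K : pzRingType}.
Implicit Types V W : lmodType K.

Lemma is_linear0 V W (f : V -> W) : is_linear f -> f 0 = 0.
Proof.
move=> lf; have := lf 1 0 0; rewrite !scale1r addr0 => /eqP.
by rewrite -subr_eq subrr => /eqP <-.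
Qed.

Lemma is_linearD V W (f : V -> W) x y : is_linear f -> f (x + y) = f x + f y.
Proof. by move=> lf; have := lf 1 x y; rewrite !scale1r. Qed.

Lemma is_linearZ V W (f : V -> W) a x : is_linear f -> f (a *: x) = a *: f x.
Proof. by move=> lf; have := lf a x 0; rewrite (@is_linear0 _ _ f) // !addr0. Qed.

Lemma is_linearN V W (f : V -> W) x : is_linear f -> f (- x) = - f x.
Proof. by move=> lf; rewrite -scaleN1r is_linearZ // scaleN1r. Qed.

Lemma is_linearB V W (f : V -> W) x y : is_linear f -> f (x - y) = f x - f y.
Proof. by move=> lf; rewrite is_linearD // is_linearN. Qed.

Lemma is_linear_comp {U V W : lmodType K} (g : V -> W) (f : U -> V) :
  is_linear g -> is_linear f -> is_linear (g \o f).
Proof. by move=> lg lf a x y /=; rewrite lf lg. Qed.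

Lemma subspaceD V (S : set V) x y : subspace S -> S x -> S y -> S (x + y).
Proof. by move=> [_ hS] Sx Sy; have := hS 1 x y Sx Sy; rewrite scale1r. Qed.

Lemma subspaceZ V (S : set V) a x : subspace S -> S x -> S (a *: x).
Proof. by move=> [S0 hS] Sx; have := hS a x 0 Sx S0; rewrite addr0. Qed.

Lemma subspaceB V (S : set V) x y : subspace S -> S x -> S y -> S (x - y).
Proof. by move=> hS Sx Sy; apply: subspaceD => //; rewrite -scaleN1r; apply: subspaceZ. Qed.

Lemma subspace_ker V W (f : V -> W) : is_linear f -> subspace (kernel f).
Proof.
move=> lf; split=> [|a x y]; rewrite /kernel /=; first exact: is_linear0.
by rewrite lf => -> ->; rewrite scaler0 addr0.
Qed.

Lemma subspaceI V (S S' : set V) : subspace S -> subspace S' -> subspace (S `&` S').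
Proof.
move=> [S0 hS] [S'0 hS']; split=> // a x y [Sx S'x] [Sy S'y].
by split; [apply: hS|apply: hS'].
Qed.

Lemma subspace_preim V W (f : V -> W) (S : set W) :
  is_linear f -> subspace S -> subspace (f @^-1` S).
Proof.
move=> lf [S0 hS]; split=> [|a x y] /=; first by rewrite is_linear0.
by rewrite lf; apply: hS.
Qed.

Lemma subspace_image V W (f : V -> W) (S : set V) :
  is_linear f -> subspace S -> subspace (f @` S).
Proof.
move=> lf [S0 hS]; split=> [|a _ _ [x Sx <-] [y Sy <-]].
  by exists 0 => //; apply: is_linear0.
by exists (a *: x + y); [apply: hS|rewrite lf].
Qed.

Lemma subspace_range V W (f : V -> W) : is_linear f -> subspace (range f).
Proof. by move=> lf; apply: subspace_image. Qed.

End LinearMaps.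

Section FiniteDimension.
Set Implicit Arguments.
Unset Strict Implicit.
Context {K : fieldType}.
Implicit Types V W : lmodType K.

(** Recursion on the list removes one generator at a time, which is the form that the inductions
    below use; [in_span_nth] recovers indexed sums. *)
Fixpoint in_span V (s : seq V) (v : V) : Prop :=
  if s is a :: s' then exists c : K, in_span s' (v - c *: a) else v = 0.

(** The generators may lie outside [S], so the property passes to subsets at once. For subspaces
    [edim_fin] moves them inside. *)
Definition fin_dim V (S : set V) : Prop :=
  exists s, forall v, S v -> in_span s v.

Definition fin_codim V (S : set V) : Prop :=
  exists s, forall v, exists2 u, S u & in_span s (v - u).

Lemma in_span0 V (s : seq V) : in_span s 0.
Proof. by elim: s => //= a s IHs; exists 0; rewrite scale0r subr0. Qed.

Lemma in_spanL V (s : seq V) a v w :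
  in_span s v -> in_span s w -> in_span s (a *: v + w).
Proof.
elim: s v w => [|b s IHs] v w /=; first by move=> -> ->; rewrite scaler0 addr0.
move=> [c hc] [d hd]; exists (a * c + d).
suff -> : a *: v + w - (a * c + d) *: b = a *: (v - c *: b) + (w - d *: b).
  exact: IHs.
by rewrite scalerBr scalerDl scalerA opprD addrACA.
Qed.

Lemma subspace_in_span V (s : seq V) : subspace (in_span s).
Proof. by split=> [|a x y]; [apply: in_span0|apply: in_spanL]. Qed.

Lemma in_span_catl V (s t : seq V) v : in_span s v -> in_span (s ++ t) v.
Proof.
elim: s v => [v ->|a s IHs v [c hc]] /=; first exact: in_span0.
by exists c; apply: IHs.
Qed.

Lemma in_span_catr V (s t : seq V) v : in_span t v -> in_span (s ++ t) v.
Proof. by elim: s v => //= a s IHs v hv; exists 0; rewrite scale0r subr0; apply: IHs. Qed.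

Lemma in_span_cat V (s t : seq V) v w :
  in_span s v -> in_span t w -> in_span (s ++ t) (v + w).
Proof.
move=> hv hw; apply: subspaceD; [exact: subspace_in_span|exact: in_span_catl|].
exact: in_span_catr.
Qed.

Lemma in_span_map V W (f : V -> W) (s : seq V) v :
  is_linear f -> in_span s v -> in_span (map f s) (f v).
Proof.
move=> lf; elim: s v => [v ->|a s IHs v [c hc]] /=; first exact: is_linear0.
by exists c; rewrite -is_linearZ // -is_linearB //; apply: IHs.
Qed.

Lemma in_span_map_inv V W (f : V -> W) (s : seq V) w :
  is_linear f -> in_span (map f s) w -> exists2 v, in_span s v & f v = w.
Proof.
move=> lf; elim: s w => [w ->|a s IHs w [c /IHs [v hv fv]]] /=.
  by exists 0 => //; apply: is_linear0.
exists (v + c *: a); first by exists c; rewrite addrK.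
by rewrite is_linearD // is_linearZ // fv subrK.
Qed.

Lemma mem_in_span V (s : seq V) v : v \in s -> in_span s v.
Proof.
elim: s => //= a s IHs; rewrite inE => /predU1P[->|/IHs hv].
  by exists 1; rewrite scale1r subrr; apply: in_span0.
by exists 0; rewrite scale0r subr0.
Qed.

Lemma in_span_sum V k (s : 'I_k -> V) v :
  in_span [seq s i | i <- enum 'I_k] v <->
  exists c : 'I_k -> K, v = \sum_(i < k) c i *: s i.
Proof.
elim: k s v => [|k IHk] s v.
  have -> : enum 'I_0 = [::] by apply: size0nil; rewrite size_enum_ord.
  by split=> [/= ->|[c ->]]; [exists (fun _ => 0)|]; rewrite big_ord0.
rewrite enum_ordSl /= -map_comp; split=> [[c /IHk [d hd]]|[c ->]].
  (* The default [c] is the coefficient at [ord0]; the others come from [d]. *)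
  exists (fun i => oapp d c (unlift ord0 i)).
  rewrite big_ord_recl unlift_none /= -[LHS](subrK (c *: s ord0)) hd addrC.
  by congr (_ + _); apply: eq_bigr => i _; rewrite liftK.
exists (c ord0); apply/IHk; exists (c \o lift ord0).
by rewrite big_ord_recl addrC addKr.
Qed.

Lemma in_span_nth V (s : seq V) v :
  in_span s v <-> exists c : 'I_(size s) -> K, v = \sum_i c i *: s`_i.
Proof.
rewrite -(@in_span_sum _ _ (fun i : 'I_(size s) => s`_i)).
suff -> : [seq s`_(val i) | i <- enum 'I_(size s)] = s by [].
by rewrite -[RHS](mkseq_nth 0) /mkseq -val_enum_ord -map_comp.
Qed.

(** Induction on [s]: let [t] generate the part of [M] inside the span of the tail. If some [n] in
    [M] has a nonzero coefficient along the head [a], a multiple of [n] cancels that coefficient in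
    any other vector of [M], so [n :: t] generates [M]; otherwise [t] does. *)
Lemma in_span_subspace V (M : set V) (s : seq V) :
  subspace M -> (forall v, M v -> in_span s v) ->
  exists t, forall v, M v <-> in_span t v.
Proof.
elim: s M => [|a s IHs] M sM Ms.
  by exists [::] => v; split=> [/Ms //|->]; case: sM.
have [|v [_ hv] //|t ht] := IHs (M `&` in_span s).
  by apply: subspaceI => //; apply: subspace_in_span.
have [[n [c [Mn c0 hc]]]|nex] :=
    pselect (exists n c, [/\ M n, c != 0 & in_span s (n - c *: a)]); last first.
  exists t => v; rewrite -ht; split=> [Mv|[] //]; split=> //.
  have [c hc] := Ms _ Mv; have [c0|c0] := eqVneq c 0.
    by move: hc; rewrite c0 scale0r subr0.
  by exfalso; apply: nex; exists v, c.
exists (n :: t) => v; split=> [Mv|[d /ht[Md _]]]; last first.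
  rewrite -[v](subrK (d *: n)).
  by apply: subspaceD => //; apply: subspaceZ.
have [d hd] := Ms _ Mv; exists (d / c); apply/ht; split.
  by apply: subspaceB => //; apply: subspaceZ.
suff -> : v - (d / c) *: n = - (d / c) *: (n - c *: a) + (v - d *: a).
  exact: in_spanL.
by rewrite scaleNr scalerBr scalerA divfK // opprB [RHS]addrC addrA subrK.
Qed.

Lemma fin_dimS V (S S' : set V) : S `<=` S' -> fin_dim S' -> fin_dim S.
Proof. by move=> SS' [s hs]; exists s => v /SS'; apply: hs. Qed.

Lemma fin_dim_in_span V (s : seq V) : fin_dim (in_span s).
Proof. by exists s. Qed.

Lemma fin_dim_image V W (f : V -> W) (S : set V) :
  is_linear f -> fin_dim S -> fin_dim (f @` S).
Proof. by move=> lf [s hs]; exists (map f s) => _ [v Sv <-]; apply: in_span_map; auto. Qed.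

(** Generators of the image are first chosen inside it, then lifted one by one to [S]. *)
Lemma in_span_lift V W (f : V -> W) (S : set V) : is_linear f -> subspace S ->
  fin_dim (f @` S) -> exists r, (forall v, in_span r v -> S v) /\
    forall v, S v -> exists2 u, in_span r u & f u = f v.
Proof.
move=> lf sS [t0 ht0].
have [t ht] := in_span_subspace (subspace_image lf sS) ht0.
suff [r [rt rS]] : exists r, map f r = t /\ forall v, in_span r v -> S v.
  exists r; split=> // v Sv; have : in_span t (f v) by apply/ht; exists v.
  by rewrite -rt => /in_span_map_inv [//|u hu fu]; exists u.
have : forall w, w \in t -> (f @` S) w by move=> w /mem_in_span /ht.
elim: t {ht} => [_|w t IHt htS].
  by exists [::]; split=> // v /= ->; case: sS.
have [v tv|r [rt rS]] := IHt; first by apply: htS; rewrite inE tv orbT.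
have [v Sv fv] := htS w (mem_head _ _).
exists (v :: r); split=> [|u [c /rS hu]] /=; first by rewrite fv rt.
by rewrite -[u](subrK (c *: v)); apply: subspaceD => //; apply: subspaceZ.
Qed.

(** The qualitative rank-nullity theorem: after subtraction of a lift of [f v], the vector [v] falls
    into the kernel. *)
Lemma fin_dim_extension V W (f : V -> W) (S : set V) : is_linear f -> subspace S ->
  fin_dim (S `&` kernel f) -> fin_dim (f @` S) -> fin_dim S.
Proof.
move=> lf sS [s hs] /(in_span_lift lf sS) [r [rS hr]].
exists (s ++ r) => v Sv; have [u hu fu] := hr v Sv.
rewrite -[v](subrK u); apply: in_span_cat => //; apply: hs; split.
  by apply: subspaceB => //; apply: rS.
by rewrite /kernel /= is_linearB // fu subrr.
Qed.

Lemma edim_fin V (S : set V) : subspace S -> (edim S <> None) <-> fin_dim S.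
Proof.
move=> sS; rewrite /edim; case: pselect => [hk|nk]; split=> //.
- move=> _; have [k /asboolP [s [_ hs]]] := hk.
  by exists [seq s i | i <- enum 'I_k] => v /hs ?; apply/in_span_sum.
- move=> [s0 /(in_span_subspace sS) [s hs]]; case: nk.
  exists (size s); apply/asboolP; exists (fun i => s`_i); split.
    by move=> i; apply/hs/mem_in_span/mem_nth.
  by move=> v /hs /in_span_nth.
Qed.

Lemma ecodim_fin V (S : set V) : (ecodim S <> None) <-> fin_codim S.
Proof.
rewrite /ecodim; case: pselect => [hk|nk]; split=> //.
- move=> _; have [k /asboolP [s hs]] := hk.
  exists [seq s i | i <- enum 'I_k] => v; have [u [c [Su ->]]] := hs v.
  by exists u => //; apply/in_span_sum; exists c; rewrite addrC addKr.
- move=> [s hs]; case: nk; exists (size s); apply/asboolP.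
  exists (fun i => s`_i) => v; have [u Su /in_span_nth [c hc]] := hs v.
  by exists u, c; split=> //; rewrite -hc addrC subrK.
Qed.

Lemma alpha_fin V W (f : V -> W) : is_linear f ->
  (alpha f <> None) <-> fin_dim (kernel f).
Proof. by move=> lf; apply/edim_fin/subspace_ker. Qed.

Lemma beta_fin V W (f : V -> W) : (beta f <> None) <-> fin_codim (range f).
Proof. exact: ecodim_fin. Qed.

End FiniteDimension.

(** * Upper triangular operators: algebra *)

Section UpperTriangular.
Set Implicit Arguments.
Unset Strict Implicit.
Context {K : fieldType} {n : nat} {Y : 'I_n -> lmodType K}.

Lemma dprodP (x y : dprod Y) : (forall i, x i = y i) -> x = y.
Proof. exact: functional_extensionality_dep. Qed.

Definition dinj k (z : Y k) : dprod Y := dfwith (fun i => 0 : Y i) k z.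

Lemma dinj_in k (z : Y k) : dinj z k = z.
Proof. exact: dfwith_in. Qed.

Lemma dinj_out k (z : Y k) i : k != i -> dinj z i = 0.
Proof. exact: dfwith_out. Qed.

Lemma is_linear_dinj k : is_linear (@dinj k).
Proof.
move=> a x y; apply: dprodP => i; have [<-|ki] := eqVneq k i.
  by rewrite dinj_in -[RHS]/(a *: dinj x k + dinj y k) !dinj_in.
by rewrite dinj_out // -[RHS]/(a *: dinj x i + dinj y i) !dinj_out // scaler0 addr0.
Qed.

Lemma is_linear_coord (i : 'I_n) : is_linear (fun x : dprod Y => x i).
Proof. by []. Qed.

Definition dtrunc (P : pred 'I_n) (x : dprod Y) : dprod Y :=
  fun i => if P i then x i else 0.

Lemma is_linear_dtrunc P : is_linear (dtrunc P).
Proof.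
move=> a x y; apply: dprodP => i; rewrite -[RHS]/(a *: dtrunc P x i + dtrunc P y i).
by rewrite /dtrunc; case: (P i) => //; rewrite scaler0 addr0.
Qed.

Context {D : forall k, Y k -> Y k} {A : forall i j : 'I_n, Y j -> Y i}.
Arguments D : clear implicits.
Arguments A : clear implicits.
Hypothesis lD : forall k, is_linear (D k).
Hypothesis lA : forall i j : 'I_n, (i < j)%N -> is_linear (A i j).
Local Notation T := (Tmat D A).

Lemma is_linear_Tmat : is_linear T.
Proof.
move=> a x y; apply: dprodP => i; rewrite -[RHS]/(a *: T x i + T y i) /Tmat.
rewrite [(a *: x + y) i](_ : _ = a *: x i + y i) // lD scalerDr addrACA; congr (_ + _).
rewrite scaler_sumr -big_split /=; apply: eq_bigr => j ij.
by rewrite -(lA ij).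
Qed.

Lemma Tmat_coord_eq (x y : dprod Y) (i : 'I_n) :
  (forall j : 'I_n, (i <= j)%N -> x j = y j) -> T x i = T y i.
Proof.
move=> xy; rewrite /Tmat xy //; congr (_ + _).
by apply: eq_bigr => j ij; rewrite xy // ltnW.
Qed.

Lemma Tmat_coord_diag (x : dprod Y) (i : 'I_n) :
  (forall j : 'I_n, (i < j)%N -> x j = 0) -> T x i = D i (x i).
Proof.
move=> xy; rewrite /Tmat big1 ?addr0 // => j ij.
by rewrite xy // is_linear0 //; apply: lA.
Qed.

Lemma Tmat_coord0 (x : dprod Y) (i : 'I_n) :
  (forall j : 'I_n, (i <= j)%N -> x j = 0) -> T x i = 0.
Proof.
move=> x0; rewrite Tmat_coord_diag => [|j /ltnW]; last exact: x0.
by rewrite x0 // is_linear0.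
Qed.

(** This set is the kernel of the block of [T] on the coordinates from [k] on. It is filtered by the
    subspaces [H j]; on a vector whose last possibly nonzero coordinate is [j], row [j] of [T]
    reduces to [D j], so each step of the filtration adds at most the dimension of one diagonal
    kernel. *)
Lemma fin_dim_tail_kernel (k : nat) :
  (forall s : 'I_n, (k <= s)%N -> fin_dim (kernel (D s))) ->
  fin_dim [set x : dprod Y | (forall i : 'I_n, (i < k)%N -> x i = 0) /\
                             (forall i : 'I_n, (k <= i)%N -> T x i = 0)].
Proof.
move=> hD; set S := [set x | _].
have sS : subspace S.
  split=> [|a x y [x0 Tx] [y0 Ty]].
    split=> i ki //; rewrite -[T 0]/(T (0 : dprod Y)).
    by rewrite is_linear0 //; apply: is_linear_Tmat.
  split=> i ki; first by rewrite -[LHS]/(a *: x i + y i) x0 // y0 // scaler0 addr0.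
  rewrite is_linear_Tmat -[LHS]/(a *: T x i + T y i).
  by rewrite Tx // Ty // scaler0 addr0.
pose H j := [set x : dprod Y | forall i : 'I_n, (j <= i)%N -> x i = 0].
have sH j : subspace (H j).
  by split=> // a x y Hx Hy i ji; rewrite -[LHS]/(a *: x i + y i) Hx // Hy // scaler0 addr0.
suff hj j : fin_dim (S `&` H j).
  by apply: fin_dimS (hj n) => x Sx; split=> // i; rewrite leqNgt ltn_ord.
elim: j => [|j IHj].
  by exists [::] => x [_ H0]; apply: dprodP => i; apply: H0.
have [nj|jn] := leqP n j.
  apply: fin_dimS IHj => x [Sx Hx]; split=> // i ji.
  by have := leq_trans nj ji; rewrite leqNgt ltn_ord.
pose o := Ordinal jn.
apply: (fin_dim_extension (@is_linear_coord o)); first exact: subspaceI.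
  apply: fin_dimS IHj => x [[Sx Hx] xo]; split=> // i.
  rewrite leq_eqVlt => /orP[/eqP ji|]; last exact: Hx.
  by have -> : i = o by apply: val_inj.
have [kj|jk] := leqP k j; last first.
  by exists [::] => _ [x [[x0 _] _] <-]; apply: x0.
apply: fin_dimS (hD o kj) => _ [x [[_ Tx] Hx] <-].
by rewrite /kernel /= -Tmat_coord_diag ?Tx.
Qed.

(** Back substitution: the highest coordinate of [y] is matched by some [D o z] up to finitely many
    dimensions. Subtracting [T (dinj z)] and the error [w] leaves a vector supported strictly below,
    to which the induction hypothesis applies. *)
Lemma head_range (k : nat) :
  (forall s : 'I_n, (s < k)%N -> fin_codim (range (D s))) ->
  exists s, forall y : dprod Y, (forall i : 'I_n, (k <= i)%N -> y i = 0) ->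
    exists2 x : dprod Y, (forall i : 'I_n, (k <= i)%N -> x i = 0) & in_span s (y - T x).
Proof.
elim: k => [|k IHk] hD.
  exists [::] => y y0; exists (0 : dprod Y) => //; rewrite is_linear0 ?subr0; last exact: is_linear_Tmat.
  by apply: dprodP => i; apply: y0.
have [s hs] := IHk (fun s sk => hD s (ltnW sk)).
have [nk|kn] := leqP n k.
  exists s => y y0; have [i ki|x x0 hx] := hs y.
    by have := leq_trans nk ki; rewrite leqNgt ltn_ord.
  by exists x => // i /ltnW; apply: x0.
pose o := Ordinal kn; have [t ht] := hD o (leqnn _).
exists (s ++ map (@dinj o) t) => y y0.
have [_ [z _ <-] hz] := ht (y o).
pose w := dinj (y o - D o z).
have [i ki|x x0 hx] := hs (y - T (dinj z) - w).
  rewrite -[LHS]/(y i - T (dinj z) i - w i) Tmat_coord_diag; last first.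
    move=> j ij; apply: dinj_out; rewrite neq_ltn.
    by rewrite (leq_ltn_trans _ ij).
  move: ki; rewrite leq_eqVlt => /orP[/eqP ki|ki].
    have <- : o = i by apply: val_inj.
    by rewrite /w !dinj_in subrr.
  have oi : o != i by rewrite neq_ltn ki.
  by rewrite /w !dinj_out // is_linear0 // y0 // !subr0.
exists (x + dinj z) => [i ki|].
  rewrite -[LHS]/(x i + dinj z i) x0; last exact: ltnW.
  by rewrite dinj_out ?addr0 // neq_ltn ki.
rewrite (is_linearD _ _ is_linear_Tmat).
have -> : y - (T x + T (dinj z)) = (y - T (dinj z) - w - T x) + w.
  by rewrite [RHS]addrAC subrK opprD addrA addrAC.
by apply: in_span_cat => //; apply: in_span_map => //; apply: is_linear_dinj.
Qed.

Lemma Tmat_fin_dim_kernel :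
  (forall s, fin_dim (kernel (D s))) -> fin_dim (kernel T).
Proof.
move=> hD; apply: fin_dimS (@fin_dim_tail_kernel 0 (fun s _ => hD s)).
by move=> x Tx; split=> // i _; rewrite Tx.
Qed.

Lemma Tmat_fin_codim_range :
  (forall s, fin_codim (range (D s))) -> fin_codim (range T).
Proof.
move=> hD; have [s hs] := @head_range n (fun s _ => hD s).
exists s => y; have [i|x _ hx] := hs y; first by rewrite leqNgt ltn_ord.
by exists (T x) => //; exists x.
Qed.

(** For [z] in the kernel of [D k], the vector [T (dinj z)] lives below [k], so [head_range] gives
    [x] supported below [k] with [T (dinj z - x)] in a fixed finite span. The preimage of that span
    is finite dimensional, and the [k]-th coordinate of [dinj z - x] is [z]. *)
Lemma diag_fin_dim_kernel (k : 'I_n) : fin_dim (kernel T) ->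
  (forall s : 'I_n, (s < k)%N -> fin_codim (range (D s))) ->
  fin_dim (kernel (D k)).
Proof.
move=> kT /head_range [s hs].
have hM : fin_dim (T @^-1` in_span s).
  apply: (fin_dim_extension is_linear_Tmat).
  - by apply: subspace_preim; [exact: is_linear_Tmat|exact: subspace_in_span].
  - exact: fin_dimS kT => x [].
  - by apply: fin_dimS (fin_dim_in_span s) => _ [x hx <-].
apply: fin_dimS (fin_dim_image (@is_linear_coord k) hM) => z Dz.
have [i ki|x x0 hx] := hs (T (dinj z)).
  rewrite Tmat_coord_diag; last first.
    by move=> j ij; apply: dinj_out; rewrite neq_ltn (leq_ltn_trans ki ij).
  have [<-|ik] := eqVneq k i; first by rewrite dinj_in.
  by rewrite dinj_out // is_linear0.
exists (dinj z - x); first by rewrite /= (is_linearB _ _ is_linear_Tmat).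
by rewrite -[LHS]/(dinj z k - x k) x0 // subr0 dinj_in.
Qed.

(** Solve [T x = dinj y] modulo the span of [s]. Row [k] then gives [y - D k (x k)] up to the
    contribution of the coordinates of [x] above [k]. These form a vector of [Q], which is finite
    dimensional because the block of [T] above [k] has a finite dimensional kernel. *)
Lemma diag_fin_codim_range (k : 'I_n) : fin_codim (range T) ->
  (forall s : 'I_n, (k < s)%N -> fin_dim (kernel (D s))) ->
  fin_codim (range (D k)).
Proof.
move=> [s hs] hD; pose tr := dtrunc (fun i : 'I_n => (k < i)%N).
have ltr : is_linear tr by apply: is_linear_dtrunc.
have lTk : is_linear (fun x => T x k).
  by move=> a x y; rewrite is_linear_Tmat.
pose L := [set x : dprod Y | forall i : 'I_n, (i <= k)%N -> x i = 0].
have sL : subspace L.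
  by split=> // a x y Lx Ly i ik; rewrite -[LHS]/(a *: x i + y i) Lx // Ly // scaler0 addr0.
have ltT : is_linear (tr \o T) by apply: is_linear_comp => //; apply: is_linear_Tmat.
pose Q := L `&` ((tr \o T) @^-1` in_span (map tr s)).
have [q hq] : fin_dim ((fun x => T x k) @` Q).
  apply: fin_dim_image => //; apply: (fin_dim_extension ltT).
  - by apply: subspaceI => //; apply: subspace_preim => //; apply: subspace_in_span.
  - apply: fin_dimS (@fin_dim_tail_kernel k.+1 hD) => x [[Lx _] Tx]; split=> i ki.
      exact: Lx.
    by have := congr1 (fun z : dprod Y => z i) Tx; rewrite /= /tr /dtrunc ki.
  - by apply: fin_dimS (fin_dim_in_span (map tr s)) => _ [x [_ hx] <-].
exists (q ++ map (fun x : dprod Y => x k) s) => y.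
have [_ [x _ <-] hx] := hs (dinj y).
exists (D k (x k)); first by exists (x k).
have -> : y - D k (x k) = T (tr x) k + (dinj y - T x) k.
  rewrite -[(dinj y - T x) k]/(dinj y k - T x k) dinj_in addrCA; congr (_ + _).
  rewrite /Tmat opprD addrCA [tr x k]/tr /dtrunc ltnn is_linear0 // add0r.
  rewrite [X in _ + (X - _)](eq_bigr (fun j => A k j (x j))) ?subrr ?addr0 // => j kj.
  by rewrite /tr /dtrunc kj.
apply: in_span_cat; last by apply: (in_span_map (@is_linear_coord k)).
apply: hq; exists (tr x) => //; split=> [i ik|].
  by rewrite /tr /dtrunc ltnNge ik.
(* Above [k] the vector [dinj y] vanishes, and [T (tr x)] agrees with [T x] because [T] is upper
   triangular. *)
rewrite /=; suff -> : tr (T (tr x)) = - 1 *: tr (dinj y - T x) + 0.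
  by apply: in_spanL; [apply: in_span_map|apply: in_span0].
apply: dprodP => i; rewrite addr0 -[RHS]/(- 1 *: tr (dinj y - T x) i) /tr /dtrunc.
case: ifP => ki; last by rewrite scaler0.
rewrite -[(dinj y - T x) i]/(dinj y i - T x i) dinj_out; last by rewrite neq_ltn ki.
rewrite sub0r scaleN1r opprK; apply: Tmat_coord_eq => j ij.
by rewrite (leq_trans ki ij).
Qed.

End UpperTriangular.

(** * The Hahn-Banach theorem *)

Section NormedSpaces.
Set Implicit Arguments.
Unset Strict Implicit.
Context {R : realType}.
Local Open Scope complex_scope.

Record nspace := NSpace {
  nsort :> lmodType R[i];
  nrm : nsort -> R;
  nrmD : forall x y, nrm (x + y) <= nrm x + nrm y;
  nrmZ : forall a x, nrm (a *: x) = Normc.normc a * nrm x;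
  nrm0_eq0 : forall x, nrm x = 0 -> x = 0 }.

Lemma normc_real (r : R) : Normc.normc r%:C = `|r|.
Proof. by rewrite /Normc.normc /= expr0n /= addr0 sqrtr_sqr. Qed.

Lemma complexN1 : - 1 = (- 1)%:C :> R[i].
Proof. by rewrite rmorphN1. Qed.

Lemma normc_ge0 (a : R[i]) : 0 <= Normc.normc a.
Proof. by case: a => a b; apply: sqrtr_ge0. Qed.

Section NormTheory.
Variable V : nspace.
Implicit Types x y : V.

Lemma nrm0 : nrm (0 : V) = 0.
Proof. by rewrite -(scale0r (0 : V)) nrmZ Normc.normc0 mul0r. Qed.

Lemma nrmN x : nrm (- x) = nrm x.
Proof.
rewrite -scaleN1r nrmZ complexN1 normc_real.
by rewrite normrN normr1 mul1r.
Qed.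

Lemma nrm_ge0 x : 0 <= nrm x.
Proof. by have := nrmD x (- x); rewrite subrr nrm0 nrmN; lra. Qed.

Lemma nrmB x y : nrm (x - y) <= nrm x + nrm y.
Proof. by rewrite -(nrmN y); apply: nrmD. Qed.

Lemma nrm_distC x y : nrm (x - y) = nrm (y - x).
Proof. by rewrite -nrmN opprB. Qed.

Lemma nrm_gt0 x : x != 0 -> 0 < nrm x.
Proof.
move=> x0; rewrite lt_neqAle nrm_ge0 andbT eq_sym; apply/eqP => /nrm0_eq0 /eqP.
exact/negP.
Qed.

Lemma nrmZr (r : R) x : nrm (r%:C *: x) = `|r| * nrm x.
Proof. by rewrite nrmZ normc_real. Qed.

End NormTheory.

Definition bounded (V W : nspace) (f : V -> W) :=
  exists2 M, 0 <= M & forall x, nrm (f x) <= M * nrm x.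

Definition blin (V W : nspace) (f : V -> W) := is_linear f /\ bounded f.

Lemma blin_id (V : nspace) : blin (@id V).
Proof. by split=> //; exists 1 => // x; rewrite mul1r. Qed.

Lemma blin_comp (U V W : nspace) (g : V -> W) (f : U -> V) :
  blin g -> blin f -> blin (g \o f).
Proof.
move=> [lg [N N0 hN]] [lf [M M0 hM]]; split; first exact: is_linear_comp.
exists (N * M) => [|x /=]; first exact: mulr_ge0.
by apply: le_trans (hN _) _; rewrite -mulrA ler_wpM2l.
Qed.

Lemma blin_add (V W : nspace) (g f : V -> W) :
  blin g -> blin f -> blin (fun x => g x + f x).
Proof.
move=> [lg [N N0 hN]] [lf [M M0 hM]]; split=> [a x y|].
  by rewrite lg lf scalerDr addrACA.
exists (N + M) => [|x]; first exact: addr_ge0.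
by apply: le_trans (nrmD _ _) _; rewrite mulrDl lerD.
Qed.

Lemma blin_opp (V W : nspace) (f : V -> W) : blin f -> blin (fun x => - f x).
Proof.
move=> [lf [M M0 hM]]; split=> [a x y|]; first by rewrite lf opprD scalerN.
by exists M => // x; rewrite nrmN.
Qed.

Lemma blin_sub (V W : nspace) (g f : V -> W) :
  blin g -> blin f -> blin (fun x => g x - f x).
Proof. by move=> bg /blin_opp; apply: blin_add. Qed.

Section HahnBanach.
Variable V : nspace.

Definition sublinear (p : V -> R) :=
  (forall x y, p (x + y) <= p x + p y) /\
  (forall t x, 0 < t -> p (t%:C *: x) <= t * p x).

Lemma sublinearZ p t x : sublinear p -> 0 < t -> p (t%:C *: x) = t * p x.
Proof.
move=> [_ hp] t0; apply: le_anti; rewrite hp //=.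
have ti : 0 < t^-1 by rewrite invr_gt0.
have := hp t^-1 (t%:C *: x) ti; rewrite scalerA -rmorphM /= mulVf ?gt_eqF // scale1r.
by rewrite mulrC ler_pdivlMr // mulrC.
Qed.

Lemma sublinear0 p : sublinear p -> p 0 = 0.
Proof.
move=> sp; have := @sublinearZ p 2 0 sp (ltr0Sn _ _); rewrite scaler0; lra.
Qed.

Lemma sublinear_ge p x : sublinear p -> - p (- x) <= p x.
Proof. by move=> sp; have := sp.1 x (- x); rewrite subrr sublinear0 //; lra. Qed.

(** For sublinear [p] this is the largest sublinear functional below [p] whose value at [- y] is at
    most [- p y]. *)
Definition tilt (p : V -> R) (y x : V) : R :=
  inf [set r | exists2 t : R, 0 <= t & r = p (x + t%:C *: y) - t * p y].

Section Tilt.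
Variables (p : V -> R) (y : V).
Hypothesis sp : sublinear p.

Lemma tilt_lbound x b :
  (forall t : R, 0 <= t -> b <= p (x + t%:C *: y) - t * p y) -> b <= tilt p y x.
Proof.
move=> hb; apply: lb_le_inf; last by move=> _ [t t0 ->]; apply: hb.
by exists (p (x + 0%:C *: y) - 0 * p y); exists 0.
Qed.

Lemma tilt_le x t : 0 <= t -> tilt p y x <= p (x + t%:C *: y) - t * p y.
Proof.
move=> t0; apply: ge_inf; last by exists t.
(* Subadditivity bounds the set from below, so that the infimum is a genuine one. *)
exists (- p (- x)) => _ [s s0 ->].
have psy : s * p y = p (s%:C *: y).
  move: s0; rewrite le_eqVlt => /predU1P[<-|s0]; last by rewrite sublinearZ.
  by rewrite scale0r sublinear0 // mul0r.
have := sp.1 (x + s%:C *: y) (- x); rewrite addrAC subrr add0r -psy; lra.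
Qed.

Lemma sublinear_tilt : sublinear (tilt p y).
Proof.
split=> [x z|c x c0].
  rewrite -lerBlDr; apply: tilt_lbound => t t0.
  rewrite lerBlDr -lerBlDl; apply: tilt_lbound => s s0.
  rewrite lerBlDl; apply: (le_trans (tilt_le (x + z) (addr_ge0 t0 s0))).
  have := sp.1 (x + t%:C *: y) (z + s%:C *: y).
  by rewrite addrACA -scalerDl -rmorphD /=; lra.
rewrite mulrC -ler_pdivrMr //; apply: tilt_lbound => t t0; rewrite ler_pdivrMr //.
apply: (le_trans (tilt_le (c%:C *: x) (mulr_ge0 (ltW c0) t0))).
by rewrite rmorphM -scalerA -scalerDr sublinearZ //; lra.
Qed.

End Tilt.

(* A sublinear functional that is minimal is additive, since tilting it in any
   direction cannot decrease it; so Zorn's lemma yields linear minorants. *)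
Lemma hahn_banach (p0 : V -> R) : sublinear p0 ->
  exists g : V -> R, [/\ forall x, g x <= p0 x, forall x y, g (x + y) = g x + g y &
    forall t x, g (t%:C *: x) = t * g x].
Proof.
move=> sp0; pose T := {p : V -> R | sublinear p /\ forall x, p x <= p0 x}.
(* The order is reversed, so that a maximal element for Zorn's lemma is a minimal functional. *)
pose le (p q : T) := `[< forall x, sval q x <= sval p x >].
have [p| p q r /asboolP pq /asboolP qr|p q /asboolP pq /asboolP qp|A totA|[p [sp pp0]] minp] :=
    @Zorn T le.
- by apply/asboolP.
- by apply/asboolP => x; apply: le_trans (qr x) (pq x).
- apply: eq_sig_hprop => [f|]; first exact: Prop_irrelevance.
  by apply/funext => x; apply: le_anti; rewrite pq qp.
- have [[q0 Aq0]|noA] := pselect (exists q0, A q0); last first.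
    by exists (exist _ p0 (conj sp0 (fun=> lexx _))) => s As; case: noA; exists s.
  (* A nonempty chain is bounded by its pointwise infimum; subadditivity survives because of two
     members of the chain the smaller one serves both arguments. *)
  pose m x := inf [set r | exists2 q, A q & r = sval q x].
  have mlb x b : (forall q, A q -> b <= sval q x) -> b <= m x.
    move=> hb; apply: lb_le_inf; last by move=> _ [q Aq ->]; apply: hb.
    by exists (sval q0 x), q0.
  have mle q x : A q -> m x <= sval q x.
    move=> Aq; apply: ge_inf; last by exists q.
    exists (- p0 (- x)) => _ [r Ar ->]; case: (svalP r) => sr rp0.
    by apply: le_trans (sublinear_ge x sr); rewrite lerN2.
  have sm : sublinear m.
    split=> [x y|t x t0].
      rewrite -lerBlDr; apply: (mlb) => q Aq; rewrite lerBlDr -lerBlDl.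
      apply: (mlb) => r Ar; rewrite lerBlDl.
      case: (totA q r Aq Ar) => /asboolP h.
        apply: le_trans (mle _ _ Ar) _; apply: le_trans ((svalP r).1.1 x y) _.
        by rewrite lerD2r.
      apply: le_trans (mle _ _ Aq) _; apply: le_trans ((svalP q).1.1 x y) _.
      by rewrite lerD2l.
    rewrite mulrC -ler_pdivrMr //; apply: (mlb) => q Aq; rewrite ler_pdivrMr //.
    apply: le_trans (mle _ _ Aq) _; rewrite mulrC; exact: (svalP q).1.2.
  have mp0 x : m x <= p0 x by apply: le_trans (mle _ _ Aq0) _; apply: (svalP q0).2.
  by exists (exist _ m (conj sm mp0)) => s As; apply/asboolP => x; apply: mle.
- have tiltp y : tilt p y = p.
    have tp x : tilt p y x <= p x.
      apply: le_trans (tilt_le y sp x (lexx _)) _.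
      by rewrite scale0r addr0 mul0r subr0.
    have tp0 x : tilt p y x <= p0 x by apply: le_trans (tp x) _.
    pose tp' : T := exist _ _ (conj (sublinear_tilt y sp) tp0).
    have /minp /(congr1 sval) // : le (exist _ p (conj sp pp0)) tp'.
    by apply/asboolP.
  (* The parameter [t = 1] in the tilt gives [p x <= p (x + y) - p y], the inequality opposite to
     subadditivity. *)
  have pD x y : p (x + y) = p x + p y.
    apply: le_anti; rewrite sp.1 /= addrC -lerBrDl -{1}(tiltp y).
    by have := tilt_le y sp x ler01; rewrite scale1r mul1r.
  have pN x : p (- x) = - p x.
    by have := pD x (- x); rewrite subrr sublinear0 //; lra.
  exists p; split=> // t x.
  have [t0|t0|->] := ltgtP t 0; last by rewrite scale0r sublinear0 // mul0r.
    have := @sublinearZ p (- t) x sp; rewrite oppr_gt0 rmorphN scaleNr pN mulNr.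
    by move=> /(_ t0) /oppr_inj.
  exact: sublinearZ.
Qed.

Lemma sublinear_nrm : sublinear (@nrm V).
Proof. by split=> [|t x t0]; [exact: nrmD|rewrite nrmZr gtr0_norm]. Qed.

Lemma norming_functional (u : V) : u != 0 ->
  exists f : V -> R[i], [/\ forall a x y, f (a *: x + y) = a * f x + f y,
    exists2 M, 0 <= M & forall x, Normc.normc (f x) <= M * nrm x & f u = 1].
Proof.
move=> u0; have sN := sublinear_nrm.
(* Domination by the tilted norm, rather than by the norm itself, forces [g (- u) <= - nrm u], hence
   [g u > 0]. *)
have [g [gle gD gZ]] := hahn_banach (sublinear_tilt u sN).
have gN x : g (- x) = - g x by rewrite -scaleN1r complexN1 gZ; lra.
have gnrm x : `|g x| <= nrm x.
  have h z : g z <= nrm z.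
    apply: le_trans (gle z) _; apply: le_trans (tilt_le u sN z (lexx _)) _.
    by rewrite scale0r addr0 mul0r subr0.
  by rewrite ler_norml h andbT lerNl -gN -(nrmN x).
have gu : 0 < g u.
  apply: lt_le_trans (nrm_gt0 u0) _; rewrite -lerN2 -gN.
  apply: le_trans (gle _) _; apply: le_trans (tilt_le u sN (- u) ler01) _.
  by rewrite scale1r addNr nrm0 mul1r sub0r.
(* The usual complexification of a real-linear functional; dividing by [h u] will normalise it. *)
pose h x : R[i] := g x +i* - g ('i%C *: x).
have hL a x y : h (a *: x + y) = a * h x + h y.
  case: a => s t; have E z : (s +i* t) *: z = s%:C *: z + t%:C *: ('i%C *: z).
    by rewrite scalerA -scalerDl; congr (_ *: z); simpc.
  have ii z : 'i%C *: ('i%C *: z) = - z.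
    rewrite scalerA -[RHS]scaleN1r; congr (_ *: z).
    by apply/eqP; rewrite eq_complex /= !mulr0 !mul0r mul1r sub0r addr0 oppr0 !eqxx.
  have Eg z : g ((s +i* t) *: z) = s * g z + t * g ('i%C *: z) by rewrite E gD !gZ.
  have Ei z : 'i%C *: ((s +i* t) *: z) = (s +i* t) *: ('i%C *: z) by rewrite !scalerA mulrC.
  rewrite /h scalerDr !gD Ei !Eg ii gN.
  by apply/eqP; rewrite eq_complex /=; apply/andP; split; apply/eqP; ring.
have hu : h u != 0.
  by rewrite eq_complex negb_and /= gt_eqF.
exists (fun x => h x / h u); split; last by rewrite divff.
  by move=> a x y; rewrite hL mulrDl mulrA.
exists (2 / Normc.normc (h u)) => [|x]; first by rewrite divr_ge0 ?normc_ge0.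
rewrite Normc.normcM Normc.normcV mulrAC ler_wpM2r ?invr_ge0 ?normc_ge0 //.
have ni : Normc.normc ('i%C : R[i]) = 1.
  by rewrite /Normc.normc expr0n /= add0r expr1n sqrtr1.
have -> : h x = (g x)%:C + 'i%C * (- g ('i%C *: x))%:C by rewrite [LHS]complexE.
apply: le_trans (le_normcD _ _) _; rewrite Normc.normcM !normc_real normrN.
rewrite ni mul1r; have := gnrm ('i%C *: x); rewrite nrmZ ni.
by have := gnrm x; lra.
Qed.

End HahnBanach.

End NormedSpaces.

(** * Projections from one-sided inverses modulo finite rank *)

Section FiniteRank.
Set Implicit Arguments.
Unset Strict Implicit.
Context {R : realType}.
Local Open Scope complex_scope.
Local Notation nspace := (@nspace R).

(** A bounded generalised inverse of [D] on a finite span, built one generator at a time: a new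
    vector [a] either is handled already or leaves a nonzero defect [D w], which a norming
    functional detects. *)
Lemma finite_lift (V W : nspace) (D : V -> W) (t : seq V) : blin D ->
  exists s : W -> V, [/\ blin s, forall y, in_span t (s y) &
    forall v, in_span t v -> D (s (D v)) = D v].
Proof.
move=> bD; have lD := bD.1; elim: t => [|a t [s [bs st hs]]].
  exists (fun=> 0); split=> // [|v ->]; last by rewrite !is_linear0.
  by split=> [b x y|]; [rewrite scaler0 addr0|exists 0 => // x; rewrite nrm0 mul0r].
pose w := a - s (D a); have ls := bs.1.
have lDsD (s' : W -> V) : is_linear s' -> is_linear (fun v => D (s' (D v))).
  by move=> ls' b x y; rewrite lD ls' lD.
have span_ext (s' : W -> V) : is_linear s' ->
    (forall v, in_span t v -> D (s' (D v)) = D v) -> D (s' (D a)) = D a ->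
    forall v, in_span (a :: t) v -> D (s' (D v)) = D v.
  move=> ls' ht ha v [c hc]; rewrite -[v](subrK (c *: a)).
  rewrite (is_linearD _ _ (lDsD _ ls')) (is_linearZ _ _ (lDsD _ ls')) ht // ha.
  by rewrite -is_linearZ // -is_linearD.
have [Dw0|Dw0] := eqVneq (D w) 0.
  exists s; split=> [//|y|].
    by exists 0; rewrite scale0r subr0.
  apply: span_ext => //; apply/esym/eqP; rewrite -subr_eq0 -is_linearB //.
  exact/eqP.
have [f [fL [M M0 hM] fu]] := norming_functional Dw0.
have f0 : f 0 = 0 by have := fL (- 1) 0 0; rewrite scaler0 addr0 mulN1r addNr.
have br : blin (fun y => f y *: w).
  split=> [b x y|]; first by rewrite fL scalerDl scalerA.
  exists (M * nrm w) => [|y]; first by rewrite mulr_ge0 // nrm_ge0.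
  by rewrite nrmZ mulrAC ler_wpM2r ?nrm_ge0.
(* The map [e] kills the image of the span of [t] and sends [D a] to [D w], so the correction below
   repairs [a] without disturbing [t]. *)
pose e y := y - D (s y); have be : blin e.
  by apply: blin_sub; [exact: blin_id|exact: blin_comp bD bs].
pose s' y := s y + f (e y) *: w.
have bs' : blin s' by apply: blin_add => //; exact: blin_comp br be.
exists s'; split=> // [y|].
  exists (f (e y)); rewrite /s' /w scalerBr addrAC addrA subrK.
  apply: subspaceB => //; first exact: subspace_in_span.
  by apply: subspaceZ => //; exact: subspace_in_span.
apply: span_ext => [|v hv|]; first exact: bs'.1.
  by rewrite /s' /e hs // subrr f0 scale0r addr0 hs.
by rewrite /s' /e -is_linearB // fu scale1r /w addrC subrK.
Qed.

Lemma finite_projection (V : nspace) (M : set V) : subspace M -> fin_dim M ->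
  exists p : V -> V, [/\ blin p, forall v, M (p v) & forall v, M v -> p v = v].
Proof.
move=> sM [s0 /(in_span_subspace sM) [s hs]].
have [p [bp ps hp]] := finite_lift s (blin_id V).
by exists p; split=> // v; [apply/hs|move/hs; apply: hp].
Qed.

(** With [p] a projection onto the range [M] of [1 - S D], the map [Q = D (1 - p) S] satisfies
    [Q D = D - D p]. Its error on the range of [D] lies in the finite dimensional space [D M], and a
    projection [r] onto that space removes it. *)
Lemma range_projection (V W : nspace) (D : V -> W) (S : W -> V) :
  blin D -> blin S -> fin_dim (range (fun x => x - S (D x))) ->
  exists P : W -> W, [/\ blin P, forall y, range D (P y) & forall x, P (D x) = D x].
Proof.
move=> bD bS; set M := range _ => fM; have lD := bD.1.
have sM : subspace M.
  by apply: subspace_range; case: (blin_sub (blin_id V) (blin_comp bS bD)).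
have [p [bp pM pid]] := finite_projection sM fM; have lp := bp.1.
pose Q y := D (S y - p (S y)).
have bQ : blin Q.
  by apply: (blin_comp bD); apply: blin_sub => //; exact: blin_comp bp bS.
have QD x : Q (D x) = D x - D (p x).
  have /pid : M (x - S (D x)) by exists x.
  rewrite (is_linearB _ _ lp) /Q -(is_linearB _ _ lD) => E; congr D.
  by rewrite -(subrKA (p x)) E addrC subrKA.
have sDM : subspace (D @` M) by apply: subspace_image.
have [r [br rM rid]] := finite_projection sDM (fin_dim_image lD fM).
exists (fun y => Q y + r (y - Q y)); split=> [|y|x].
- apply: blin_add => //; apply: (blin_comp br); apply: blin_sub => //; exact: blin_id.
- apply: subspaceD; [exact: subspace_range|by eexists|].
  by have [z _ <-] := rM (y - Q y); exists z.
- rewrite QD opprB addrCA subrr addr0 rid ?subrK //.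
  by exists (p x).
Qed.

(** The map [E = 1 - S D] fixes the kernel of [D], and [D E = (1 - D S) D] has finite rank. A finite
    lift [s] therefore corrects it: [E - s D E] takes its values in the kernel. *)
Lemma kernel_projection (V W : nspace) (D : V -> W) (S : W -> V) :
  blin D -> blin S -> fin_dim (range (fun y => y - D (S y))) ->
  exists P : V -> V, [/\ blin P, forall x, kernel D (P x) & forall x, kernel D x -> P x = x].
Proof.
move=> bD bS fM; have lD := bD.1.
pose E x := x - S (D x); have bE : blin E.
  by apply: blin_sub; [exact: blin_id|exact: blin_comp bS bD].
have sE : subspace (range E) by apply: subspace_range; case: bE.
have fE : fin_dim (D @` range E).
  apply: fin_dimS fM => _ [_ [x _ <-] <-]; exists (D x) => //.
  by rewrite /E is_linearB.
have [r [_ hr]] := in_span_lift lD sE fE.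
have [s [bs _ hs]] := finite_lift r bD.
exists (fun x => E x - s (D (E x))); split=> [|x|x Dx].
- by apply: blin_sub => //; apply: (blin_comp bs); apply: blin_comp bD bE.
- have [|u /hs hu Du] := hr (E x); first by exists x.
  by rewrite /kernel /= is_linearB // -Du hu subrr.
- have -> : E x = x by rewrite /E Dx is_linear0 ?subr0 //; case: bS.
  by rewrite Dx is_linear0 ?subr0 //; case: bs.
Qed.

End FiniteRank.

(** * The open mapping theorem and inverses modulo finite rank *)

Section OpenMapping.
Set Implicit Arguments.
Unset Strict Implicit.
Context {R : realType}.
Local Open Scope complex_scope.
Local Notation nspace := (@nspace R).

(** Sequences with geometrically decreasing increments suffice for the constructions below; the rate
    in the conclusion replaces a topology. *)
Definition complete (V : nspace) := forall (u : nat -> V) (c : R),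
  (forall n, nrm (u n.+1 - u n) <= c * 2^-1 ^+ n) ->
  exists l d, forall n, nrm (u n - l) <= d * 2^-1 ^+ n.

Lemma half_gt0 n : 0 < 2^-1 ^+ n :> R.
Proof. by rewrite exprn_gt0 // invr_gt0. Qed.

Lemma le_geometric (a b c : R) : (forall n, a <= b + c * 2^-1 ^+ n) -> a <= b.
Proof.
move=> h; apply/ler_addgt0Pr => e e0.
pose n := (Num.truncn (c / e)).+1; apply: le_trans (h n) _; rewrite lerD2l.
rewrite exprVn ler_pdivrMr ?exprn_gt0 // mulrC -ler_pdivrMr //.
apply: le_trans (ltW (truncnS_gt _)) _; rewrite -/n -natrX ler_nat.
by rewrite ltnW // ltn_expl.
Qed.

Lemma geometric_limit (V : nspace) (u : nat -> V) (l : V) (c d : R) :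
  (forall n, nrm (u n.+1 - u n) <= c * 2^-1 ^+ n) ->
  (forall n, nrm (u n - l) <= d * 2^-1 ^+ n) -> nrm (u 0%N - l) <= 2 * c.
Proof.
move=> hu hl; apply: (@le_geometric _ _ (d - 2 * c)) => n.
have h : nrm (u 0%N - u n) <= 2 * c - 2 * c * 2^-1 ^+ n.
  elim: n => [|n IHn]; first by rewrite subrr nrm0 expr0 mulr1 subrr.
  have := nrmD (u 0%N - u n) (u n - u n.+1); rewrite subrKA (nrm_distC (u n)).
  by have := hu n; rewrite exprS; lra.
have := nrmD (u 0%N - u n) (u n - l); rewrite subrKA.
by have := hl n; lra.
Qed.

(* Baire's theorem for the cover of W by the closures of the images of the
   balls of radius n. *)
Lemma baire_image (V W : nspace) (f : V -> W) : complete W ->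
  (forall y, exists x, f x = y) ->
  exists (n : nat) (y0 : W) (r : R), 0 < r /\
    forall y, nrm (y - y0) <= r -> forall e, 0 < e ->
      exists2 x, nrm x <= n%:R & nrm (y - f x) <= e.
Proof.
move=> cW surj; apply: contrapT => nex.
(* If no ball works, every ball contains one of at most half the radius that avoids the image of the
   ball of radius [n]. Iteration gives nested balls whose common point has no preimage. *)
have step (q : nat * (W * R)) : exists q' : W * R, 0 < q.2.2 ->
    [/\ nrm (q'.1 - q.2.1) <= q.2.2 / 2, 0 < q'.2, q'.2 <= q.2.2 / 2 &
        forall x, nrm x <= q.1%:R -> q'.2 < nrm (q'.1 - f x)].
  case: q => n [y r] /=; have [r0|] := pselect (0 < r); last by exists (y, r).
  have r20 : 0 < r / 2 by rewrite divr_gt0.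
  apply: contrapT => nq; apply: nex; exists n, y, (r / 2); split=> // z zy e e0.
  apply: contrapT => nx; apply: nq; exists (z, Num.min e (r / 2)) => _ /=.
  split=> [//|||x xn]; first by rewrite lt_min e0.
    by rewrite ge_min lexx orbT.
  rewrite ltNge; apply/negP => h; apply: nx; exists x => //.
  by apply: le_trans h _; rewrite ge_min lexx.
have [g hg] := choice step.
pose fix a n := if n is p.+1 then g (p, a p) else (0, 1).
pose y n := (a n).1; pose r n := (a n).2.
have r0 n : 0 < r n by elim: n => [|n IHn]; [exact: ltr01|have [] := hg (n, a n) IHn].
have hy n := hg (n, a n) (r0 n).
have yS n : nrm (y n.+1 - y n) <= r n / 2 by have [] := hy n.
have rS n : r n.+1 <= r n / 2 by have [] := hy n.
have yf n x : nrm x <= n%:R -> r n.+1 < nrm (y n.+1 - f x) by have [_ _ _] := hy n; apply.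
have rnj n j : r (n + j)%N <= r n * 2^-1 ^+ j.
  elim: j => [|j IHj]; first by rewrite addn0 expr0 mulr1.
  by rewrite addnS exprS; have := rS (n + j)%N; lra.
have ynj n j : nrm (y (n + j.+1)%N - y (n + j)%N) <= r n / 2 * 2^-1 ^+ j.
  by rewrite addnS; have := yS (n + j)%N; have := rnj n j; lra.
have [l [d hl]] := cW y _ (ynj 0%N).
have yl n : nrm (y n - l) <= r n.
  have h j : nrm (y (n + j)%N - l) <= (d * 2^-1 ^+ n) * 2^-1 ^+ j.
    by rewrite -mulrA -exprD.
  have := geometric_limit (ynj n) h; rewrite addn0; lra.
have [x fx] := surj l; pose n := (Num.truncn (nrm x)).+1.
have := yf n x (ltW (truncnS_gt _)); rewrite fx ltNge => /negP; apply; exact: yl.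
Qed.

Theorem open_mapping (V W : nspace) (f : V -> W) : complete V -> complete W ->
  blin f -> (forall y, exists x, f x = y) ->
  exists2 M, 0 <= M & forall y, exists2 x, f x = y & nrm x <= M * nrm y.
Proof.
move=> cV cW [lf [B B0 hB]] surj.
have [n [y0 [r [r0 hr]]]] := baire_image cW surj.
(* A vector of norm [r] is a difference of two points of the ball. Each is approximated within
   [r / 4] by the image of a vector of norm at most [n], so the difference has an approximate
   preimage of norm at most [2 n] with error [r / 2]. *)
pose M := 2 * n%:R / r; have M0 : 0 <= M by rewrite divr_ge0 ?mulr_ge0 // ltW.
have approx z : exists x, nrm x <= M * nrm z /\ nrm (z - f x) <= nrm z / 2.
  have [->|z0] := eqVneq z 0.
    by exists 0; rewrite (is_linear0 lf) subrr !nrm0 mulr0 mul0r.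
  have nz := nrm_gt0 z0; pose t := r / nrm z; have t0 : 0 < t by rewrite divr_gt0.
  have ball : nrm (t%:C *: z + y0 - y0) <= r.
    by rewrite addrK nrmZr gtr0_norm // divfK ?gt_eqF.
  have e0 : 0 < r / 4 by rewrite divr_gt0.
  have [x1 x1n hx1] := hr _ ball _ e0.
  have ball0 : nrm (y0 - y0) <= r by rewrite subrr nrm0 ltW.
  have [x2 x2n hx2] := hr _ ball0 _ e0.
  have hx : nrm (x1 - x2) <= 2 * n%:R by have := nrmB x1 x2; lra.
  have hf : nrm (t%:C *: z - f (x1 - x2)) <= r / 2.
    have -> : t%:C *: z - f (x1 - x2) = (t%:C *: z + y0 - f x1) - (y0 - f x2).
      rewrite (is_linearB _ _ lf) !opprB [X in X + (f x2 - y0)]addrAC.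
      by rewrite [f x2 - y0]addrC [RHS]addrA addrK [RHS]addrAC addrA.
    by have := nrmB (t%:C *: z + y0 - f x1) (y0 - f x2); lra.
  exists (t^-1%:C *: (x1 - x2)); rewrite (is_linearZ _ _ lf) nrmZr.
  have ti : 0 < t^-1 by rewrite invr_gt0.
  have tE : t^-1 = nrm z / r by rewrite /t invf_div.
  rewrite gtr0_norm //; split.
    apply: le_trans (ler_wpM2l (ltW ti) hx) _; rewrite tE /M.
    by rewrite le_eqVlt; apply/orP; left; apply/eqP; ring.
  have -> : z - t^-1%:C *: f (x1 - x2) = t^-1%:C *: (t%:C *: z - f (x1 - x2)).
    by rewrite scalerBr scalerA -rmorphM /= mulVf ?gt_eqF // scale1r.
  rewrite nrmZr gtr0_norm //; apply: le_trans (ler_wpM2l (ltW ti) hf) _.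
  by rewrite tE mulrA divfK ?gt_eqF.
have [g hg] := choice approx.
exists (2 * M) => [|z]; first by rewrite mulr_ge0.
(* Each step adds an approximate preimage of the residual, which is thereby halved; the increments
   sum to at most [2 * M * nrm z]. *)
pose fix a k := if k is p.+1 then a p + g (z - f (a p)) else 0.
have az k : nrm (z - f (a k)) <= nrm z * 2^-1 ^+ k.
  elim: k => [|k IHk]; first by rewrite (is_linear0 lf) subr0 expr0 mulr1.
  have [_] := hg (z - f (a k)); rewrite exprS /= (is_linearD _ _ lf) opprD addrA; lra.
have aS k : nrm (a k.+1 - a k) <= M * nrm z * 2^-1 ^+ k.
  rewrite /= addrAC subrr add0r; have [h _] := hg (z - f (a k)).
  by apply: le_trans h _; rewrite -mulrA ler_wpM2l.
have [l [d hl]] := cV a _ aS; exists l.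
  apply/esym/eqP; rewrite -subr_eq0; apply/eqP/nrm0_eq0/le_anti; rewrite nrm_ge0 andbT.
  apply: (@le_geometric _ _ (nrm z + B * d)) => k; rewrite add0r mulrDl.
  have := nrmD (z - f (a k)) (f (a k) - f l); rewrite subrKA -(is_linearB _ _ lf).
  have := hB (a k - l); have := ler_wpM2l B0 (hl k); have := az k; lra.
have := geometric_limit aS hl; rewrite /= sub0r nrmN; lra.
Qed.

Definition pair_nspace (V W : nspace) : nspace.
Proof.
refine (@NSpace R (V * W)%type (fun p => nrm p.1 + nrm p.2) _ _ _).
- by move=> p q /=; rewrite addrACA lerD // nrmD.
- by move=> a p /=; rewrite !nrmZ mulrDr.
- move=> [x y] /= /eqP; rewrite paddr_eq0 ?nrm_ge0 // => /andP[/eqP/nrm0_eq0 -> /eqP/nrm0_eq0 ->].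
  by [].
Defined.

Lemma complete_pair (V W : nspace) : complete V -> complete W -> complete (pair_nspace V W).
Proof.
move=> cV cW u c hu.
have [|l1 [d1 h1]] := cV (fun n => (u n).1) c.
  by move=> n; apply: le_trans (hu n); rewrite /= lerDl nrm_ge0.
have [|l2 [d2 h2]] := cW (fun n => (u n).2) c.
  by move=> n; apply: le_trans (hu n); rewrite /= lerDr nrm_ge0.
by exists (l1, l2), (d1 + d2) => n; rewrite mulrDl /= lerD.
Qed.

(** * The direct sum with the sum norm *)

Section DirectSum.
Variables (n : nat) (Y : 'I_n -> nspace).

Definition dprod_nspace : nspace.
Proof.
refine (@NSpace R (dprod (fun k => Y k : lmodType R[i])) (fun x => \sum_i nrm (x i)) _ _ _).
- by move=> x y; rewrite -big_split /=; apply: ler_sum => i _; apply: nrmD.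
- by move=> a x; rewrite mulr_sumr; apply: eq_bigr => i _; rewrite -nrmZ.
- move=> x /eqP; rewrite psumr_eq0 => [|i _]; last exact: nrm_ge0.
  by move=> /allP x0; apply: dprodP => i; apply/nrm0_eq0/eqP/x0; rewrite mem_index_enum.
Defined.

Lemma nrm_coord (x : dprod_nspace) i : nrm (x i) <= nrm x.
Proof.
by rewrite /= (bigD1 i) //= lerDl sumr_ge0 // => j _; rewrite nrm_ge0.
Qed.

Lemma complete_dprod : (forall i, complete (Y i)) -> complete dprod_nspace.
Proof.
move=> cY u c hu.
have h i : exists l, exists d, forall k, nrm (u k i - l) <= d * 2^-1 ^+ k.
  by apply: (cY i (fun k => u k i) c) => k; apply: le_trans (hu k); apply: nrm_coord.
pose l i := sval (cid (h i)); have hl i := svalP (cid (h i)).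
pose d i := sval (cid (hl i)); have hd i := svalP (cid (hl i)).
exists (l : dprod_nspace), (\sum_i d i) => k; rewrite mulr_suml.
by apply: ler_sum => i _; apply: hd.
Qed.

Lemma blin_coord i : @blin R dprod_nspace (Y i) (fun x => x i).
Proof. by split=> //; exists 1 => // x; rewrite mul1r nrm_coord. Qed.

Lemma blin_dinj i : @blin R (Y i) dprod_nspace (@dinj _ _ (fun k => Y k : lmodType R[i]) i).
Proof.
split; first exact: is_linear_dinj.
exists 1 => // x; rewrite mul1r /= (bigD1 i) //= dinj_in big1 ?addr0 // => j ji.
by rewrite dinj_out ?nrm0 // eq_sym.
Qed.

Lemma blin_dprod (V : nspace) (f : V -> dprod_nspace) :
  (forall i, @blin R V (Y i) (fun x => f x i)) -> blin f.
Proof.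
move=> hf; split=> [a x y|].
  by apply: dprodP => i; case: (hf i) => lf _; rewrite lf.
have h i := cid2 (hf i).2; exists (\sum_i s2val (h i)) => [|x].
  by apply: sumr_ge0 => i _; case: (h i).
by rewrite mulr_suml; apply: ler_sum => i _; case: (h i).
Qed.

End DirectSum.

Lemma blin_sum (V W : nspace) (I : Type) (r : seq I) (P : pred I) (f : I -> V -> W) :
  (forall i, P i -> blin (f i)) -> blin (fun x => \sum_(i <- r | P i) f i x).
Proof.
move=> hf; elim: r => [|i r IHr].
  split=> [a x y|]; first by rewrite !big_nil scaler0 addr0.
  by exists 0 => // x; rewrite big_nil nrm0 mul0r.
rewrite (_ : (fun x => _) = fun x =>
    (if P i then f i x else 0) + \sum_(j <- r | P j) f j x); last first.
  by apply/funext => x; rewrite big_cons; case: (P i); rewrite ?add0r.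
apply: blin_add => //; case Pi: (P i); first exact: hf.
by split=> [a x y|]; [rewrite scaler0 addr0|exists 0 => // x; rewrite nrm0 mul0r].
Qed.

(** The intervals of radius [2 * c * 2^-1 ^+ n] around [u n] are nested; the limit is the supremum
    of their left ends. *)
Lemma complete_real (u : nat -> R) c : (forall n, `|u n.+1 - u n| <= c * 2^-1 ^+ n) ->
  exists l, forall n, `|u n - l| <= 2 * c * 2^-1 ^+ n.
Proof.
move=> hu; have hc : 0 <= c by have := hu 0%N; rewrite expr0 mulr1; apply: le_trans.
pose v n := u n - 2 * c * 2^-1 ^+ n; pose w n := u n + 2 * c * 2^-1 ^+ n.
have vS n : v n <= v n.+1.
  by have := hu n; rewrite ler_norml /v exprS => /andP[+ _]; lra.
have wS n : w n.+1 <= w n.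
  by have := hu n; rewrite ler_norml /w exprS => /andP[_ +]; lra.
have vm n m : (n <= m)%N -> v n <= v m.
  by elim: m => [|m IHm]; [rewrite leqn0 => /eqP ->|rewrite leq_eqVlt =>
    /predU1P[-> //|/IHm] h; apply: le_trans h _].
have wm n m : (n <= m)%N -> w m <= w n.
  by elim: m => [|m IHm]; [rewrite leqn0 => /eqP ->|rewrite leq_eqVlt =>
    /predU1P[-> //|/IHm] h; apply: le_trans _ h].
have vw n : v n <= w n by rewrite /v /w; have := mulr_ge0 hc (ltW (half_gt0 n)); lra.
have vwm n m : v n <= w m.
  have [nm|mn] := leqP n m; first exact: le_trans (vm _ _ nm) (vw _).
  exact: le_trans (vw _) (wm _ _ (ltnW mn)).
exists (sup (range v)) => n.
have supP : has_sup (range v).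
  by split; [exists (v 0%N), 0%N|exists (w 0%N) => _ [k _ <-]; apply: vwm].
have h1 : v n <= sup (range v) by apply: ub_le_sup; [exact: supP.2|exists n].
have h2 : sup (range v) <= w n.
  by apply: ge_sup; [exact: supP.1|move=> _ [k _ <-]; apply: vwm].
by rewrite ler_norml; move: h1 h2; rewrite /v /w; lra.
Qed.

Definition scalar_nspace : nspace.
Proof.
refine (@NSpace R (R[i]^o : lmodType R[i]) (fun z : R[i] => Normc.normc z) _ _ _).
- by move=> x y; apply: le_normcD.
- by move=> a x; apply: Normc.normcM.
- by move=> x; apply: Normc.eq0_normc.
Defined.

Lemma normc_ge_parts (z : R[i]) :
  [/\ `|complex.Re z| <= Normc.normc z, `|complex.Im z| <= Normc.normc z &
      Normc.normc z <= `|complex.Re z| + `|complex.Im z|].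
Proof.
case: z => a b /=; split.
- by rewrite -sqrtr_sqr ler_wsqrtr // lerDl sqr_ge0.
- by rewrite -sqrtr_sqr ler_wsqrtr // lerDr sqr_ge0.
- rewrite -[leRHS]ger0_norm ?addr_ge0 // -sqrtr_sqr ler_wsqrtr //.
  rewrite sqrrD !real_normK ?num_real // addrAC lerDl mulrn_wge0 //.
Qed.

Lemma complete_scalar : complete scalar_nspace.
Proof.
move=> u c hu.
have [|a ha] := @complete_real (fun n => complex.Re (u n)) c.
  move=> n; apply: le_trans (hu n); have [+ _ _] := normc_ge_parts (u n.+1 - u n).
  by case: (u n.+1) (u n) => ? ? [].
have [|b hb] := @complete_real (fun n => complex.Im (u n)) c.
  move=> n; apply: le_trans (hu n); have [_ + _] := normc_ge_parts (u n.+1 - u n).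
  by case: (u n.+1) (u n) => ? ? [].
exists (a +i* b), (4 * c) => n; have [_ _] := normc_ge_parts (u n - (a +i* b)).
move=> h; apply: le_trans h _; have := ha n; have := hb n.
by case: (u n) => x y /=; lra.
Qed.

(** * Inverses modulo finite rank *)

Lemma surjective_parametrix (V W : nspace) (T : V -> W) : complete V -> complete W ->
  blin T -> fin_dim (kernel T) -> (forall y, exists x, T x = y) ->
  exists S : W -> V, [/\ blin S, fin_dim (range (fun x => x - S (T x))) &
    fin_dim (range (fun y => y - T (S y)))].
Proof.
move=> cV cW bT fT surj; have lT := bT.1.
have [M M0 hM] := open_mapping cV cW bT surj.
have [p [bp pT pid]] := finite_projection (subspace_ker lT) fT.
have /choice[g hg] y : exists x, T x = y /\ nrm x <= M * nrm y.
  by have [x ? ?] := hM y; exists x.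
(* The choice [g] of preimages need not be linear, but [q] kills the kernel of [T], so [q (g y)]
   depends only on [y] and is linear in it. *)
pose q x := x - p x; have bq : blin q by apply: blin_sub => //; exact: blin_id.
have qT x x' : T x = T x' -> q x = q x'.
  move=> Txx'; apply/eqP; rewrite -subr_eq0 -(is_linearB _ _ bq.1) /q pid ?subrr //.
  by rewrite /kernel /= is_linearB // Txx' subrr.
exists (fun y => q (g y)); split.
- split=> [a x y|].
    rewrite -bq.1; apply: qT; rewrite lT.
    by rewrite !(hg _).1.
  have [N N0 hN] := bq.2; exists (N * M) => [|y]; first exact: mulr_ge0.
  by apply: le_trans (hN _) _; rewrite -mulrA ler_wpM2l //; case: (hg y).
- apply: fin_dimS fT => _ [x _ <-]; rewrite (qT _ x) ?(hg _).1 // /q subKr.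
  exact: pT.
- exists [::] => _ [y _ <-] /=; rewrite is_linearB // (hg y).1.
  by rewrite (_ : T (p (g y)) = 0) ?subr0 ?subrr //; apply: pT.
Qed.

(* Vectors completing the range are adjoined one at a time as extra scalar
   coordinates of the domain, until the operator becomes surjective. *)
Theorem fredholm_parametrix (V W : nspace) (T : V -> W) : complete V -> complete W ->
  blin T -> fin_dim (kernel T) -> fin_codim (range T) ->
  exists S : W -> V, [/\ blin S, fin_dim (range (fun x => x - S (T x))) &
    fin_dim (range (fun y => y - T (S y)))].
Proof.
move=> cV cW bT fT [s hs].
have {hs} : forall y, exists x, in_span s (y - T x).
  by move=> y; have [_ [x _ <-]] := hs y; exists x.
elim: s V cV T bT fT => [|a s IHs] V cV T bT fT hs.
  apply: surjective_parametrix => // y; have [x /= /eqP] := hs y.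
  by rewrite subr_eq0 => /eqP ->; exists x.
have lT := bT.1.
pose V' := pair_nspace V scalar_nspace.
pose T' (x : V') : W := T x.1 + x.2 *: a.
have lT' : is_linear T'.
  move=> c x y; rewrite /T' -[(c *: x + y).1]/(c *: x.1 + y.1) lT.
  rewrite -[(c *: x + y).2]/(c * x.2 + y.2) scalerDl -scalerA scalerDr.
  by rewrite addrACA.
have bT' : blin T'.
  split=> //; have [M M0 hM] := bT.2; exists (M + nrm a) => [|x].
    by rewrite addr_ge0 ?nrm_ge0.
  apply: le_trans (nrmD _ _) _; rewrite nrmZ /=.
  have := hM x.1; have := mulr_ge0 M0 (normc_ge0 x.2).
  by have := mulr_ge0 (nrm_ge0 a) (nrm_ge0 x.1); lra.
have fT' : fin_dim (kernel T').
  have lsnd : is_linear (snd : V' -> scalar_nspace) by [].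
  have linl : is_linear (fun x : V => (x, 0) : V').
    by move=> c x y; congr (_, _); rewrite -[RHS]/(c * 0 + 0) mulr0 addr0.
  apply: (fin_dim_extension lsnd); first exact: subspace_ker.
    apply: fin_dimS (fin_dim_image linl fT) => -[x c] [Tx /= c0].
    by rewrite /kernel /= in c0 Tx *; exists x; rewrite -?c0 // -Tx /T' c0 scale0r addr0.
  exists [:: (1 : scalar_nspace)] => c _; exists c.
  by rewrite -[c *: _]/(c * 1) mulr1 subrr.
have [|y|S [bS [t ht] [t' ht']]] := IHs V' _ T' bT' fT'.
- exact: complete_pair cV complete_scalar.
- have [x [c hc]] := hs y; exists (x, c).
  by rewrite /T' /= opprD addrA.
have lfst : is_linear (fst : V' -> V) by [].
exists (fun y => (S y).1); split.
- split=> [c x y|]; first by rewrite bS.1.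
  have [M M0 hM] := bS.2; exists M => // y; apply: le_trans (hM y).
  by rewrite lerDl normc_ge0.
- exists (map fst t) => _ [x _ <-].
  have -> : x - (S (T x)).1 = fst ((x, 0) - S (T' (x, 0))).
    by rewrite /T' /= scale0r addr0.
  by apply: in_span_map => //; apply: ht; exists (x, 0).
- exists (t' ++ [:: a]) => _ [y _ <-].
  have -> : y - T (S y).1 = (y - T' (S y)) + (S y).2 *: a.
    by rewrite /T' opprD addrA subrK.
  apply: in_span_cat; first by apply: ht'; exists y.
  by exists (S y).2; rewrite subrr.
Qed.

End OpenMapping.

(** * Upper triangular operators: analysis *)

Section NormedModuleBridge.
Set Implicit Arguments.
Unset Strict Implicit.
Context {R : realType}.
Local Open Scope complex_scope.
Local Notation nspace := (@nspace R).

Section NormedModules.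
Variable X : normedModType R[i].

Lemma norm_real (x : X) : `|x| = (complex.Re `|x|)%:C.
Proof. by rewrite RRe_real // normr_real. Qed.

Definition nspace_of : nspace.
Proof.
refine (@NSpace R (X : lmodType R[i]) (fun x => complex.Re `|x|) _ _ _).
- by move=> x y; rewrite -lecR rmorphD /= -!norm_real ler_normD.
- by move=> a x; apply: complexI; rewrite rmorphM /= -!norm_real normrZ.
- by move=> x x0; apply/normr0_eq0; rewrite norm_real x0.
Defined.

Lemma nrm_nspace_of (x : X) : `|x| = (@nrm _ nspace_of x)%:C.
Proof. exact: norm_real. Qed.

End NormedModules.

Lemma complete_nspace_of (X : completeNormedModType R[i]) : complete (nspace_of X).
Proof.
move=> u c hu.
have c0 : 0 <= c by have := hu 0%N; rewrite expr0 mulr1; apply: le_trans (nrm_ge0 _).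
have unm n k : nrm (u (n + k)%N - u n) <= 2 * c * 2^-1 ^+ n.
  have : nrm (u (n + k)%N - u n) <= 2 * c * 2^-1 ^+ n * (1 - 2^-1 ^+ k).
    elim: k => [|k IHk]; first by rewrite addn0 subrr nrm0 expr0 subrr mulr0.
    have := nrmD (u (n + k.+1)%N - u (n + k)%N) (u (n + k)%N - u n); rewrite subrKA.
    by have := hu (n + k)%N; rewrite addnS exprD exprS; lra.
  have := mulr_ge0 (mulr_ge0 c0 (ltW (half_gt0 n))) (ltW (half_gt0 k)); lra.
have small (e : R) : 0 < e -> exists n, 2 * c * 2^-1 ^+ n < e.
  move=> e0; apply: contrapT => nn; have : e <= 0; last by rewrite leNgt e0.
  apply: (le_geometric (c := 2 * c)) => n; rewrite add0r leNgt; apply/negP => h.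
  by apply: nn; exists n.
have : cvg (u @ \oo).
  apply: cauchy_cvg; apply: cauchy_exP => e e0.
  have eE : e = (complex.Re e)%:C by rewrite RRe_real // gtr0_real.
  have [|n hn] := small (complex.Re e); first by rewrite -ltcR -eE.
  exists (u n); exists n => // m /= nm; rewrite -ball_normE /ball_ /= nrm_nspace_of eE ltcR.
  apply: le_lt_trans hn; rewrite nrm_distC -(@subnKC n m) //; exact: unm.
move=> /cvg_ex[l ul]; exists l, (2 * c) => n.
apply/ler_addgt0Pr => e e0.
have /cvgrPdist_lt/(_ e%:C) : u @ \oo --> (l : X) by [].
rewrite ltcR => /(_ e0) [N _ hN].
have := hN (n + N)%N (leq_addl _ _); rewrite /= nrm_nspace_of ltcR nrm_distC => h.
have := nrmD (u n - u (n + N)%N) (u (n + N)%N - l).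
by rewrite subrKA (nrm_distC (u n)); have := unm n N; lra.
Qed.

Section BoundedOperators.
Variables X Y : normedModType R[i].
Implicit Types f : X -> Y.

Let pack_linear f (lf : linear f) : {linear X -> Y} :=
  HB.pack f (GRing.isLinear.Build _ _ _ _ f lf).

Lemma blin_bounded_op f : bounded_op f -> @blin _ (nspace_of X) (nspace_of Y) f.
Proof.
move=> [lf cf]; split=> //.
have /linear_boundedP/pinfty_ex_gt0 [M M0 hM] :
    bounded_near (pack_linear lf) (nbhs (0 : X)).
  exact/linear_bounded_continuous.
have ME : M = (complex.Re M)%:C by rewrite RRe_real // gtr0_real.
exists (complex.Re M) => [|x]; first by rewrite -lecR -ME ltW.
by have := hM x; rewrite !nrm_nspace_of ME -rmorphM lecR.
Qed.

Lemma bounded_op_blin f : @blin _ (nspace_of X) (nspace_of Y) f -> bounded_op f.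
Proof.
move=> [lf [M M0 hM]]; split=> //.
apply/(linear_bounded_continuous (pack_linear lf))/linear_boundedP.
exists M%:C; split; first by rewrite ger0_real // lecR.
move=> r Mr x; rewrite nrm_nspace_of; apply: le_trans (_ : M%:C * `|x| <= _).
  by rewrite nrm_nspace_of -rmorphM lecR.
by rewrite ler_wpM2r // ltW.
Qed.

End BoundedOperators.

(** Here [M] is the kernel of [1 - P], hence closed, and the kernel of [P] is a closed
    complement. *)
Lemma complemented_projection (X : normedModType R[i]) (M : set X)
    (P : nspace_of X -> nspace_of X) :
  blin P -> (forall x, M (P x)) -> (forall x, M x -> P x = x) -> complemented M.
Proof.
move=> bP MP Pid; have lP := bP.1.
have closed_kernel (f : nspace_of X -> nspace_of X) : blin f -> closed (kernel f : set X).
  move=> /bounded_op_blin[_ cf].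
  have -> : (kernel f : set X) = f @^-1` [set x : X | x = 0] by [].
  apply: preimage_closed; last first.
    exact/accessible_closed_set1/hausdorff_accessible/norm_hausdorff.
  by move=> x _; apply: cf.
split.
  have -> : M = kernel (fun x : nspace_of X => x - P x) :> set X.
    apply/seteqP; split=> [x /Pid Px|x /eqP].
      by rewrite /kernel /= Px subrr.
    by rewrite subr_eq0 => /eqP ->; apply: MP.
  by apply: closed_kernel; apply: blin_sub => //; exact: blin_id.
exists (kernel P); split; first exact: subspace_ker.
split; first exact: closed_kernel.
split=> [|v].
  apply/seteqP; split=> [x [/Pid Px Kx]|x ->]; first by rewrite -Px.
  by split; [rewrite -(is_linear0 lP); apply: MP|exact: is_linear0].
exists (P v), (v - P v); split=> //; split.
  by rewrite /kernel /= is_linearB // (Pid (P v)) ?subrr.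
by rewrite addrC subrK.
Qed.

End NormedModuleBridge.

Section TriangularOperators.
Set Implicit Arguments.
Unset Strict Implicit.
Context {R : realType} {n : nat} {X : 'I_n -> completeNormedModType R[i]}.
Variables (D : forall k, X k -> X k) (A : forall i j : 'I_n, X j -> X i).
Arguments D : clear implicits.
Arguments A : clear implicits.
Hypothesis bD : forall k, bounded_op (D k).
Hypothesis bA : forall i j : 'I_n, (i < j)%N -> bounded_op (A i j).
Local Notation XX := (dprod_nspace (fun k => nspace_of (X k))).
Local Notation T := (Tmat (Y := fun k => (X k : lmodType R[i])) D A).

Lemma blin_Tmat : @blin R XX XX T.
Proof.
apply: blin_dprod => i.
have bc j := @blin_coord R n (fun k => nspace_of (X k)) j.
have b1 := blin_comp (blin_bounded_op (bD i)) (bc i).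
have b2 (j : 'I_n) : (i < j)%N -> @blin R XX (nspace_of (X i)) (A i j \o (fun x : XX => x j)).
  by move=> ij; apply: (blin_comp (blin_bounded_op (bA ij)) (bc j)).
exact: (blin_add b1 (blin_sum _ b2)).
Qed.

Hypothesis fT : fin_dim (kernel T).
Hypothesis cT : fin_codim (range T).

Lemma Tmat_parametrix : exists S : XX -> XX,
  [/\ blin S, fin_dim (range (fun x : XX => x - S (T x))) &
      fin_dim (range (fun y : XX => y - T (S y)))].
Proof.
have cXX : complete XX by apply: complete_dprod => i; apply: complete_nspace_of.
exact: (fredholm_parametrix cXX cXX blin_Tmat fT cT).
Qed.

Let lD k : is_linear (D k) := (bD k).1.
Let lA (i j : 'I_n) (ij : (i < j)%N) : is_linear (A i j) := (bA ij).1.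
Local Notation inj k := (@dinj R[i] n (fun k => (X k : lmodType R[i])) k).
Local Notation blin_inj k := (@blin_dinj R n (fun k => nspace_of (X k)) k).
Local Notation blin_crd k := (@blin_coord R n (fun k => nspace_of (X k)) k).

(** The first column of [T] is concentrated in its diagonal entry, so the corner entry of [S] is a
    left inverse of [D k] modulo finite rank. *)
Lemma complemented_first_range (k : 'I_n) :
  (forall i : 'I_n, (k <= i)%N) -> complemented (range (D k)).
Proof.
move=> kmin; have [S [bS [s hs] _]] := Tmat_parametrix.
have bDk := blin_bounded_op (bD k).
have bSk := blin_comp (blin_crd k) (blin_comp bS (blin_inj k)).
have TE x : inj k (D k x) = T (inj k x).
  apply: dprodP => i; have [<-|ki] := eqVneq k i.
    rewrite dinj_in (Tmat_coord_diag lA) ?dinj_in // => j kj.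
    by rewrite dinj_out // neq_ltn kj.
  rewrite dinj_out // (Tmat_coord0 lD lA) // => j ij.
  by rewrite dinj_out // neq_ltn (leq_trans _ ij) // ltn_neqAle ki kmin.
have [|P [bP PD PDid]] := range_projection bDk bSk.
  exists (map (fun x : XX => x k) s) => _ [x _ <-] /=.
  have -> : x - S (inj k (D k x)) k = (fun z : XX => z k) ((inj k x : XX) - S (T (inj k x))).
    by rewrite TE /= -[RHS]/(inj k x k - S (T (inj k x)) k) dinj_in.
  by apply: (in_span_map (blin_crd k).1); apply: hs; exists (inj k x).
by apply: complemented_projection bP PD _ => _ [x _ <-].
Qed.

(** The last row of [T] is concentrated in its diagonal entry, so the corner entry of [S] is a right
    inverse of [D k] modulo finite rank. *)
Lemma complemented_last_kernel (k : 'I_n) :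
  (forall i : 'I_n, (i <= k)%N) -> complemented (kernel (D k)).
Proof.
move=> kmax; have [S [bS _ [s hs]]] := Tmat_parametrix.
have bDk := blin_bounded_op (bD k).
have bSk := blin_comp (blin_crd k) (blin_comp bS (blin_inj k)).
have [|P [bP PD PDid]] := kernel_projection bDk bSk.
  exists (map (fun x : XX => x k) s) => _ [y _ <-] /=.
  have -> : y - D k (S (inj k y) k) = (fun z : XX => z k) ((inj k y : XX) - T (S (inj k y))).
    rewrite /= -[RHS]/(inj k y k - T (S (inj k y)) k) dinj_in (Tmat_coord_diag lA) //.
    by move=> j; rewrite ltnNge kmax.
  by apply: (in_span_map (blin_crd k).1); apply: hs; exists (inj k y).
exact: complemented_projection bP PD PDid.
Qed.

End TriangularOperators.

Lemma big_eaddn_None (I : eqType) (r : seq I) (P : pred I) (F : I -> enat) (i : I) :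
  i \in r -> P i -> F i = None -> \big[eaddn/Some 0%N]_(j <- r | P j) F j = None.
Proof.
elim: r => // j r IHr; rewrite inE big_cons => /predU1P[<- Pi Fi|ir Pi Fi].
  by rewrite Pi Fi.
by case: (P j); rewrite IHr //; case: (F j).
Qed.

Lemma bounded_op_subl (R : realType) (X : normedModType R[i]) (f : X -> X) (l : R[i]) :
  bounded_op f -> bounded_op (subl f l).
Proof.
move=> /blin_bounded_op bf; apply: bounded_op_blin; apply: blin_sub bf _.
split=> [a x y|]; first by rewrite scalerDr !scalerA mulrC.
by exists (Normc.normc l) => [|x]; [exact: normc_ge0|rewrite nrmZ].
Qed.

(* n = m.+2 >= 2; the spaces X_1,...,X_n are indexed by 'I_n (0-based):
   X_1 = X ord0, X_n = X ord_max; indices 2..n-1 are 0 < s < m.+1. *)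
Theorem mainTheorem10 (R : realType) (m : nat)
  (X : 'I_m.+2 -> completeNormedModType R[i])
  (D : forall k : 'I_m.+2, X k -> X k)
  (hD : forall k, bounded_op (D k))
  (hcc : forall (s : 'I_m.+2), (0 < s)%N -> (s < m.+1)%N ->
          forall l : R[i], complements_condition (subl (D s) l))
  (A : forall i j : 'I_m.+2, X j -> X i)
  (hA : forall i j : 'I_m.+2, (i < j)%N -> bounded_op (A i j)) :
  let Dl := fun (k : 'I_m.+2) (l : R[i]) => subl (D k) l in
  let T := Tmat (Y := fun k => (X k : lmodType R[i])) D A in
  let Delta1 := [set l : R[i] | exists k : 'I_m.+2, (0 < k)%N /\ (k < m.+1)%N /\
      ((alpha (Dl k l) = None /\
        \big[eaddn/Some 0%N]_(s < m.+2 | (s < k)%N) beta (Dl s l) = None /\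
        (forall s : 'I_m.+2, (0 < s)%N -> (s < k)%N -> alpha (Dl s l) <> None))
    \/ (beta (Dl k l) = None /\
        \big[eaddn/Some 0%N]_(s < m.+2 | (k < s)%N) alpha (Dl s l) = None /\
        (forall s : 'I_m.+2, (k < s)%N -> (s < m.+1)%N -> beta (Dl s l) <> None)))] in
  let Delta2 := [set l : R[i] |
      (alpha (Dl ord_max l) = None /\
        \big[eaddn/Some 0%N]_(s < m.+2 | (s < m.+1)%N) beta (Dl s l) = None /\
        (forall s : 'I_m.+2, (0 < s)%N -> (s < m.+1)%N -> alpha (Dl s l) <> None))
    \/ (beta (Dl ord0 l) = None /\
        \big[eaddn/Some 0%N]_(s < m.+2 | (0 < s)%N) alpha (Dl s l) = None /\
        (forall s : 'I_m.+2, (0 < s)%N -> (s < m.+1)%N -> beta (Dl s l) <> None))] in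
  let Delta := (Delta1 `|` Delta2)
      `&` [set l | left_fredholm (Dl ord0 l)]
      `&` [set l | right_fredholm (Dl ord_max l)] in
  \bigcup_(k in [set: 'I_m.+2]) [set l : R[i] | ~ fredholm (Dl k l)]
  = [set l : R[i] | ~ fredholm (subl T l)] `|` Delta.
Proof.
move=> Dl T Delta1 Delta2 Delta.
have bDl l k : bounded_op (Dl k l) by apply: bounded_op_subl.
have lD l k : is_linear (Dl k l) by case: (bDl l k).
have lA (i j : 'I_m.+2) : (i < j)%N -> is_linear (A i j) by move=> /hA[].
have TE l : subl T l = Tmat (Y := fun k => (X k : lmodType R[i])) (fun k => Dl k l) A.
  by apply/funext => x; apply: dprodP => i; rewrite /Tmat addrAC.
have lT l := is_linear_Tmat (lD l) lA.
have aP l k := alpha_fin (lD l k).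
have bP l k := beta_fin (Dl k l).
apply/seteqP; split=> l.
- move=> [k _ nFk].
  have [[aT bT]|nT] := pselect (fredholm (subl T l)); last by left.
  right; rewrite TE in aT bT.
  have {}aT := (alpha_fin (lT l)).1 aT; have {}bT := (beta_fin _).1 bT.
  have ha (j : 'I_m.+2) : (forall s : 'I_m.+2, (s < j)%N -> beta (Dl s l) <> None) ->
      alpha (Dl j l) <> None.
    by move=> hs; apply/aP/(diag_fin_dim_kernel (lD l) lA aT) => s /hs /bP.
  have hb (j : 'I_m.+2) : (forall s : 'I_m.+2, (j < s)%N -> alpha (Dl s l) <> None) ->
      beta (Dl j l) <> None.
    by move=> hs; apply/bP/(diag_fin_codim_range (lD l) lA bT) => s /hs /aP.
  have bA (i j : 'I_m.+2) : (i < j)%N -> bounded_op (A i j) by apply: hA.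
  split; last first.
    split; first by apply: hb => s; rewrite ltnNge -ltnS ltn_ord.
    by apply: (complemented_last_kernel (bDl l) bA aT bT) => i; rewrite -ltnS ltn_ord.
  split; last first.
    have c0 : complemented (range (Dl ord0 l)).
      exact: (complemented_first_range (bDl l) bA aT bT).
    by split; [apply: ha|split; [case: c0|]].
  (* Were every [alpha] finite, [hb] would make every [beta] finite, and the non-Fredholm entry [k]
     could not exist. *)
  have [[j0 aj0]|afin] := pselect (exists j, alpha (Dl j l) = None); last first.
    case: nFk; split; first by move=> ak; apply: afin; exists k.
    by apply: hb => s _ sN; apply: afin; exists s.
  have := @arg_minnP _ j0 (fun j => `[< alpha (Dl j l) = None >]) val.
  case=> [|j /asboolP aj jmin]; first exact/asboolP.
  have ajs (s : 'I_m.+2) : (s < j)%N -> alpha (Dl s l) <> None.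
    by move=> sj sN; have := jmin s (asboolT sN); rewrite leqNgt sj.
  have bsum : \big[eaddn/Some 0%N]_(s < m.+2 | (s < j)%N) beta (Dl s l) = None.
    apply: contrapT => bfin; apply: (ha j) => // s sj sN; apply: bfin.
    by apply: (@big_eaddn_None _ _ _ _ s); rewrite ?mem_index_enum.
  have [jm|mj] := ltnP j m.+1.
    left; exists j; split.
      (* The minimal index is not the first, for which [ha] has no condition to meet. *)
      by rewrite lt0n; apply/eqP => j0'; apply: (ha j) => // s; rewrite j0'.
    by split=> //; left; split=> //; split=> // s _; apply: ajs.
  have jE : j = ord_max.
    by apply/val_inj/eqP; rewrite eqn_leq mj andbT -ltnS ltn_ord.
  by right; left; rewrite -jE; split=> //; rewrite jE in bsum ajs; split=> // s _; apply: ajs.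
(* Conversely, Fredholm diagonal entries make [T] Fredholm, and each of (a) to (d) names an entry
   with an infinite [alpha] or [beta]. *)
- move=> [nT|[[[[k [_ [_ [[ak _]|[bk _]]]]]|[[ak _]|[bk _]]] _] _]].
  + apply: contrapT => nex; apply: nT; rewrite TE.
    have Fk k : fredholm (Dl k l) by apply: contrapT => nF; apply: nex; exists k.
    split; first by apply/alpha_fin/(Tmat_fin_dim_kernel (lD l) lA) => [|s]; [|apply/aP; case: (Fk s)].
    by apply/beta_fin/(Tmat_fin_codim_range (lD l) lA) => s; apply/bP; case: (Fk s).
  + by exists k => // -[].
  + by exists k => // -[].
  + by exists ord_max => // -[].
  + by exists ord0 => // -[].
Qed.
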